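(* (GBC) Let $A$ be a (proper) class. If the forcing $\mathbb F_A$ admits forcing relations for atomic formulas, then there is a truth predicate for $\mathcal L_{\mathrm{Ord},\omega}(\in,A)$.
   Context: $\mathrm{Coll}(\omega,V)$ is the class of finite injective partial functions $f:\omega\to V$, ordered by reverse inclusion. $\mathbb F_A=\mathrm{Coll}(\omega,V)\sqcup\{e_{n,m}:n,m\in\omega\}\sqcup\{a_n:n\in\omega\}$, where for $f\in\mathrm{Coll}(\omega,V)$: $f\le e_{n,m}$ iff $f(n)\in f(m)$, and $f\le a_n$ iff $f(n)\in A$; the top $\mathbb 1=\emptyset$ is above all $e_{n,m}$ and $a_n$ (so $e_{n,m}$, $a_n$ are suprema of those classes of conditions). A forcing relation for atomic formulas: relations $p\Vdash\sigma\in\tau$, $p\Vdash\sigma\subseteq\tau$, $p\Vdash\sigma=\tau$ on $\mathbb F_A$-names with (a) $p\Vdash\sigma\in\tau$ iff densely many $q\le p$ have $\langle\rho,r\rangle\in\tau$ with $q\le r$, $q\Vdash\sigma=\rho$; (b) $p\Vdash\sigma=\tau$ iff $p\Vdash\sigma\subseteq\tau$ and $p\Vdash\tau\subseteq\sigma$; (c) $p\Vdash\sigma\subseteq\tau$ iff whenever $\langle\rho,r\rangle\in\sigma$ and $q'\le p,r$ there is $q\le q'$ with $q\Vdash\rho\in\tau$. $\mathcal L_{\mathrm{Ord},\omega}(\in,\hat A)$: formulas built from $x=y$, $x\in y$, $x\in\hat A$ by negation, set-sized conjunctions with finitely many free variables in total, and single universal quantifiers. A truth predicate for it is a class $\mathbb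 T$ of pairs $\langle\varphi,\vec a\rangle$ ($\vec a$ a valuation of free variables) with: atomic formulas judged correctly ($a=b$, $a\in b$, $a\in A$); $\mathbb T(\bigwedge_i\varphi_i,\vec a)$ iff $\mathbb T(\varphi_i,\vec a)$ for all $i$; $\mathbb T(\neg\varphi,\vec a)$ iff not $\mathbb T(\varphi,\vec a)$; $\mathbb T(\forall x\varphi,\vec a)$ iff $\mathbb T(\varphi,b^\frown\vec a)$ for all $b$. *)

(* Defs.v *)
Set Implicit Arguments.

Declare Scope gb_scope.
Delimit Scope gb_scope with gb.

(** * Gödel-Bernays class theory with global choice

    A theorem of GBC is rendered as a statement about every two-sorted
    structure (sets and classes) that satisfies the axioms of GBC.  "Set",
    "class", "finite", "formula", ... are always meant in the sense of such a
    structure [M], which may be ill-founded when seen from outside. *)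

Record structure := Structure {
  vset : Type;
  vclass : Type;
  mem : vset -> vset -> Prop;
  cmem : vset -> vclass -> Prop
}.

Arguments mem {M} x y : rename.
Arguments cmem {M} x X : rename.

Notation "x ∈ y" := (mem x y) (at level 70, no associativity) : gb_scope.
Notation "x ∈c X" := (cmem x X) (at level 70, no associativity) : gb_scope.
Open Scope gb_scope.

(** The formulas without class quantifiers, which are those allowed in class
    comprehension.  Set variables are de Bruijn indices; class variables are
    parameters. *)
Inductive fml : Type :=
| f_eq (i j : nat)
| f_mem (i j : nat)
| f_cmem (i k : nat)
| f_neg (phi : fml)
| f_and (phi psi : fml)
| f_all (phi : fml).

Definition scons {X : Type} (x : X) (e : nat -> X) (n : nat) : X :=
  match n with 0 => x | S n => e n end.

Fixpoint sat {M : structure} (e : nat -> vset M) (E : nat -> vclass M)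
    (phi : fml) : Prop :=
  match phi with
  | f_eq i j => e i = e j
  | f_mem i j => e i ∈ e j
  | f_cmem i k => e i ∈c E k
  | f_neg phi => ~ sat e E phi
  | f_and phi psi => sat e E phi /\ sat e E psi
  | f_all phi => forall x, sat (scons x e) E phi
  end.

Definition is_empty {M : structure} (z : vset M) : Prop :=
  forall y, ~ y ∈ z.

Definition subset {M : structure} (x y : vset M) : Prop :=
  forall z, z ∈ x -> z ∈ y.

Definition is_succ {M : structure} (s x : vset M) : Prop :=
  forall y, y ∈ s <-> y ∈ x \/ y = x.

Definition is_upair {M : structure} (p x y : vset M) : Prop :=
  forall z, z ∈ p <-> z = x \/ z = y.

Definition is_opair {M : structure} (p x y : vset M) : Prop :=
  exists u v, is_upair u x x /\ is_upair v x y /\ is_upair p u v.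

(** [rel R x y] is "<x, y> is in R" for a set [R]; [crel] and [crel3] are the
    same for classes of pairs and of triples <x, <y, z>>. *)
Definition rel {M : structure} (R x y : vset M) : Prop :=
  exists p, is_opair p x y /\ p ∈ R.

Definition crel {M : structure} (R : vclass M) (x y : vset M) : Prop :=
  exists p, is_opair p x y /\ p ∈c R.

Definition crel3 {M : structure} (R : vclass M) (x y z : vset M) : Prop :=
  exists u, is_opair u y z /\ crel R x u.

Definition inductive_set {M : structure} (w : vset M) : Prop :=
  (exists z, z ∈ w /\ is_empty z) /\
  (forall x, x ∈ w -> exists s, s ∈ w /\ is_succ s x).

Record GBC (M : structure) : Prop := {
  gbc_set_ext : forall x y : vset M, (forall z, z ∈ x <-> z ∈ y) -> x = y;
  gbc_class_ext : forall X Y : vclass M,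
    (forall z, z ∈c X <-> z ∈c Y) -> X = Y;
  gbc_pairing : forall x y : vset M, exists p, is_upair p x y;
  gbc_union : forall x : vset M, exists u,
    forall z, z ∈ u <-> exists y, y ∈ x /\ z ∈ y;
  gbc_power : forall x : vset M, exists p, forall z, z ∈ p <-> subset z x;
  gbc_infinity : exists w : vset M, inductive_set w;
  gbc_foundation : forall X : vclass M,
    (exists x, x ∈c X) ->
    exists x, x ∈c X /\ forall y, y ∈ x -> ~ y ∈c X;
  gbc_comprehension : forall (phi : fml) (e : nat -> vset M)
      (E : nat -> vclass M),
    exists X : vclass M, forall x, x ∈c X <-> sat (scons x e) E phi;
  (* [F] need not be total, so separation is included. *)
  gbc_replacement : forall F : vclass M,
    (forall x y z, crel F x y -> crel F x z -> y = z) ->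
    forall a, exists b, forall y, y ∈ b <-> exists x, x ∈ a /\ crel F x y;
  gbc_global_choice : exists C : vclass M,
    (forall x y z, crel C x y -> crel C x z -> y = z) /\
    (forall x, ~ is_empty x -> exists y, y ∈ x /\ crel C x y)
}.

(** * Functions, ordinals, finiteness *)

Definition is_relation {M : structure} (f : vset M) : Prop :=
  forall p, p ∈ f -> exists x y, is_opair p x y.

Definition is_function {M : structure} (f : vset M) : Prop :=
  is_relation f /\ forall x y z, rel f x y -> rel f x z -> y = z.

Definition is_injective {M : structure} (f : vset M) : Prop :=
  forall x x' y, rel f x y -> rel f x' y -> x = x'.

Definition in_dom {M : structure} (f x : vset M) : Prop :=
  exists y, rel f x y.

Definition in_ran {M : structure} (f y : vset M) : Prop :=
  exists x, rel f x y.

Definition transitive_set {M : structure} (x : vset M) : Prop :=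
  forall y, y ∈ x -> subset y x.

Definition is_ordinal {M : structure} (x : vset M) : Prop :=
  transitive_set x /\ forall y, y ∈ x -> transitive_set y.

Definition is_nat {M : structure} (n : vset M) : Prop :=
  forall w, inductive_set w -> n ∈ w.

Definition is_finite {M : structure} (x : vset M) : Prop :=
  exists n f, is_nat n /\ is_function f /\ is_injective f /\
    (forall i, in_dom f i <-> i ∈ n) /\ (forall y, in_ran f y <-> y ∈ x).

(** [tagged k u x] is "u = <k, x>", where the standard numeral [k] is coded as
    the [k]-fold iterated singleton of the empty set. *)
Fixpoint is_tag {M : structure} (k : nat) (t : vset M) : Prop :=
  match k with
  | 0 => is_empty t
  | S k => exists s, is_tag k s /\ is_upair t s s
  end.

Definition tagged {M : structure} (k : nat) (u x : vset M) : Prop :=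
  exists t, is_tag k t /\ is_opair u t x.

Definition tagged2 {M : structure} (k : nat) (u x y : vset M) : Prop :=
  exists v, is_opair v x y /\ tagged k u v.

(** * Forcing relations for atomic formulas *)

(** Since membership is well-founded in a model of GBC, a set is a [P]-name
    iff it lies in a set [D] all of whose elements consist of pairs <rho, r>
    with [rho] in [D] and [r] a condition. *)
Definition is_name {M : structure} (P : vset M -> Prop) (sigma : vset M)
    : Prop :=
  exists D, sigma ∈ D /\
    forall tau, tau ∈ D -> forall u, u ∈ tau ->
      exists rho r, is_opair u rho r /\ rho ∈ D /\ P r.

Definition is_atomic_forcing {M : structure} (P : vset M -> Prop)
    (le : vset M -> vset M -> Prop) (Fin Fsub Feq : vclass M) : Prop :=
  forall p sigma tau, P p -> is_name P sigma -> is_name P tau ->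
    (crel3 Fin p sigma tau <->
       forall p', le p' p -> exists q, le q p' /\
         exists rho r, rel tau rho r /\ le q r /\ crel3 Feq q sigma rho) /\
    (crel3 Feq p sigma tau <->
       crel3 Fsub p sigma tau /\ crel3 Fsub p tau sigma) /\
    (crel3 Fsub p sigma tau <->
       forall rho r, rel sigma rho r ->
       forall q', le q' p -> le q' r -> exists q, le q q' /\
         crel3 Fin q rho tau).

Definition admits_atomic_forcing {M : structure} (P : vset M -> Prop)
    (le : vset M -> vset M -> Prop) : Prop :=
  exists Fin Fsub Feq : vclass M, is_atomic_forcing P le Fin Fsub Feq.

(** * The forcing F_A *)

Definition is_coll {M : structure} (f : vset M) : Prop :=
  is_function f /\ is_injective f /\ is_finite f /\
  forall n, in_dom f n -> is_nat n.

(** The disjoint union is realised by tags: a finite injection f is the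
    condition <0, f>, e_{n,m} is <1, <n, m>> and a_n is <2, n>. *)
Definition cond_coll {M : structure} (p f : vset M) : Prop :=
  is_coll f /\ tagged 0 p f.

Definition cond_e {M : structure} (p n m : vset M) : Prop :=
  is_nat n /\ is_nat m /\ tagged2 1 p n m.

Definition cond_a {M : structure} (p n : vset M) : Prop :=
  is_nat n /\ tagged 2 p n.

Definition FA_cond {M : structure} (p : vset M) : Prop :=
  (exists f, cond_coll p f) \/ (exists n m, cond_e p n m) \/
  (exists n, cond_a p n).

Inductive FA_le {M : structure} (A : vclass M) (p q : vset M) : Prop :=
| FA_le_coll f g :
    cond_coll p f -> cond_coll q g -> subset g f -> FA_le A p q
| FA_le_e f n m x y :
    cond_coll p f -> cond_e q n m -> rel f n x -> rel f m y -> x ∈ y ->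
    FA_le A p q
| FA_le_a f n x :
    cond_coll p f -> cond_a q n -> rel f n x -> x ∈c A -> FA_le A p q
| FA_le_top g :
    FA_cond p -> cond_coll q g -> is_empty g -> FA_le A p q
| FA_le_refl :
    FA_cond p -> p = q -> FA_le A p q.

(** * The infinitary language L_{Ord,omega}(∈, A) *)

(** Variables are ordinals, and formulas are coded as sets: x = y, x ∈ y, x ∈ A,
    negation, the conjunction of a set [Phi] of formulas, and ∀x. *)
Definition code_eq {M : structure} (u x y : vset M) : Prop := tagged2 0 u x y.
Definition code_mem {M : structure} (u x y : vset M) : Prop := tagged2 1 u x y.
Definition code_inA {M : structure} (u x : vset M) : Prop := tagged 2 u x.
Definition code_neg {M : structure} (u v : vset M) : Prop := tagged 3 u v.
Definition code_conj {M : structure} (u Phi : vset M) : Prop := tagged 4 u Phi.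
Definition code_all {M : structure} (u x v : vset M) : Prop := tagged2 5 u x v.

(** A set function [F] whose domain is a set of formulas closed under immediate
    subformulas and which maps each of them to its set of free variables.  As
    codes have larger rank than their immediate subformulas, such functions
    agree on common arguments, and the union of their domains is the class of
    all formulas. *)
Definition is_fv_function {M : structure} (F : vset M) : Prop :=
  is_function F /\
  forall u s, rel F u s ->
    (exists x y, is_ordinal x /\ is_ordinal y /\ code_eq u x y /\
       is_upair s x y) \/
    (exists x y, is_ordinal x /\ is_ordinal y /\ code_mem u x y /\
       is_upair s x y) \/
    (exists x, is_ordinal x /\ code_inA u x /\ is_upair s x x) \/
    (exists v, code_neg u v /\ rel F v s) \/
    (exists Phi, code_conj u Phi /\ (forall v, v ∈ Phi -> in_dom F v) /\
       (forall x, x ∈ s <-> exists v t, v ∈ Phi /\ rel F v t /\ x ∈ t) /\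
       is_finite s) \/
    (exists x v t, is_ordinal x /\ code_all u x v /\ rel F v t /\
       forall y, y ∈ s <-> y ∈ t /\ y <> x).

(** [free_vars u s]: [u] is a formula and [s] is the set of its free
    variables. *)
Definition free_vars {M : structure} (u s : vset M) : Prop :=
  exists F, is_fv_function F /\ rel F u s.

(** The domain of a valuation may contain variables that are not free in the
    formula, so that the same valuation serves for a conjunction and for its
    conjuncts. *)
Definition is_valuation {M : structure} (u a : vset M) : Prop :=
  is_function a /\ is_finite a /\ (forall x, in_dom a x -> is_ordinal x) /\
  exists s, free_vars u s /\ forall x, x ∈ s -> in_dom a x.

Definition is_update {M : structure} (a' a x b : vset M) : Prop :=
  is_relation a' /\
  forall y c, rel a' y c <-> (y = x /\ c = b) \/ (y <> x /\ rel a y c).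

Record is_truth_predicate {M : structure} (A T : vclass M) : Prop := {
  truth_dom : forall w, w ∈c T ->
    exists u a, is_opair w u a /\ is_valuation u a;
  truth_eq : forall u a x y, is_valuation u a -> code_eq u x y ->
    (crel T u a <-> exists b c, rel a x b /\ rel a y c /\ b = c);
  truth_mem : forall u a x y, is_valuation u a -> code_mem u x y ->
    (crel T u a <-> exists b c, rel a x b /\ rel a y c /\ b ∈ c);
  truth_inA : forall u a x, is_valuation u a -> code_inA u x ->
    (crel T u a <-> exists b, rel a x b /\ b ∈c A);
  truth_conj : forall u a Phi, is_valuation u a -> code_conj u Phi ->
    (crel T u a <-> forall v, v ∈ Phi -> crel T v a);
  truth_neg : forall u a v, is_valuation u a -> code_neg u v ->
    (crel T u a <-> ~ crel T v a);
  truth_all : forall u a x v, is_valuation u a -> code_all u x v ->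
    (crel T u a <-> forall b a', is_update a' a x b -> crel T v a')
}.

(* Main.v *)
(** Let g be the generic function, a bijection from omega to V.  Replacing each
    free variable by a number and each quantifier over V by a conjunction over
    omega turns a formula u into an infinitary propositional combination of the
    assertions g(n) ∈ g(m) and g(n) ∈ A, which are expressed by the conditions
    e_{n,m} and a_n.  In negation normal form, every such combination is
    expressed by a single equation between two names, by recursion on u: there
    are names turning conjunctions and disjunctions of equations into one
    equation.  So the atomic forcing relation yields a forcing relation for u.  A
    finite injection p that determines the values a of the variables decides u,
    and by homogeneity its decision depends on u and a only; it is the truth
    value of u at a. *)

From Stdlib Require Import Arith Lia ClassicalEpsilon FunctionalExtensionality
  PropExtensionality.
Require Import Defs.

Set Implicit Arguments.

(* Names are sets, so the translation of formulas into pairs of names is a recursion with set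
   values, each of which is determined by a set-sized partial solution; class comprehension may
   quantify over those. For this, every assertion must depend on set-many others: a quantifier over
   [V] would not allow it, a conjunction over omega does. The class [Feq] then evaluates all
   translations at once.

   The negation of an equation is not an equation, so each formula is translated twice, once as true
   and once as false. Equations s_i = t_i are joined into {s_i : i} = {t_i : i}. For their
   disjunction let x = {s_i : i} and let y_j be x with s_j replaced by t_j; then x = y_j says s_j =
   t_j, and x ∈ Y for Y = {y_j : j} is the equation {x} ∪ Y = Y. Both devices break down if some s_i
   = t_j with i ≠ j can be forced, so every name carries a label that identifies its assertion. *)
Existing Class GBC.

(** * Definable classes *)

Fixpoint cren (r : nat -> nat) (phi : fml) : fml :=
  match phi with
  | f_cmem i k => f_cmem i (r k)
  | f_neg phi => f_neg (cren r phi)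
  | f_and phi psi => f_and (cren r phi) (cren r psi)
  | f_all phi => f_all (cren r phi)
  | _ => phi
  end.

Definition upr (r : nat -> nat) (n : nat) : nat :=
  match n with 0 => 0 | S n => S (r n) end.

Fixpoint vren (r : nat -> nat) (phi : fml) : fml :=
  match phi with
  | f_eq i j => f_eq (r i) (r j)
  | f_mem i j => f_mem (r i) (r j)
  | f_cmem i k => f_cmem (r i) k
  | f_neg phi => f_neg (vren r phi)
  | f_and phi psi => f_and (vren r phi) (vren r psi)
  | f_all phi => f_all (vren (upr r) phi)
  end.

Section Definability.
Context {M : structure}.
Notation V := (vset M).
Notation env := (nat -> V).

Lemma sat_cren phi : forall r (e : env) E,
  sat e E (cren r phi) <-> sat e (fun n => E (r n)) phi.
Proof.
  induction phi; intros r e E; simpl; try tauto.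
  - rewrite IHphi; tauto.
  - rewrite IHphi1, IHphi2; tauto.
  - split; intros H x; apply IHphi; auto.
Qed.

Lemma sat_vren phi : forall r (e : env) E,
  sat e E (vren r phi) <-> sat (fun n => e (r n)) E phi.
Proof.
  induction phi; intros r e E; simpl; try tauto.
  - rewrite IHphi; tauto.
  - rewrite IHphi1, IHphi2; tauto.
  - assert (K : forall x, (fun n => scons x e (upr r n)) = scons x (fun n => e (r n))).
    { intros x; apply functional_extensionality; intros [|n]; reflexivity. }
    split; intros H x; specialize (H x); [rewrite IHphi, K in H | rewrite IHphi, K]; auto.
Qed.

(** [DP] and [DF]: predicates and functions on environments that are defined by
    a formula without class quantifiers; [D1] and [D2] are the resulting classes
    of sets and of pairs. *)
Definition DP (P : env -> Prop) : Prop :=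
  exists phi E, forall e, P e <-> sat e E phi.

Definition DF (t : env -> V) : Prop := DP (fun e => e 0 = t (fun n => e (S n))).

Definition D1 (P : V -> Prop) : Prop := exists X : vclass M, forall x, P x <-> x ∈c X.

Definition D2 (R : V -> V -> Prop) : Prop :=
  exists X : vclass M, forall x y, R x y <-> crel X x y.

Lemma DP_iff P Q : (forall e, P e <-> Q e) -> DP Q -> DP P.
Proof. intros H [phi [E K]]; exists phi, E; intros e; rewrite H; auto. Qed.

Lemma DP_neg P : DP P -> DP (fun e => ~ P e).
Proof. intros [phi [E H]]; exists (f_neg phi), E; intros e; simpl; rewrite H; tauto. Qed.

(** Each formula brings its own class parameters. They are interleaved, those of [P] at the even
    indices and those of [Q] at the odd ones. *)
Lemma DP_and P Q : DP P -> DP Q -> DP (fun e => P e /\ Q e).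
Proof.
  intros [phi [E H]] [psi [F K]].
  exists (f_and (cren (fun n => 2 * n) phi) (cren (fun n => S (2 * n)) psi)).
  exists (fun n => if Nat.even n then E (Nat.div2 n) else F (Nat.div2 n)).
  intros e; cbn [sat]; rewrite !sat_cren.
  replace (fun n => if Nat.even (2 * n) then E (Nat.div2 (2 * n)) else F (Nat.div2 (2 * n)))
    with E.
  2:{ apply functional_extensionality; intros n.
      rewrite Nat.even_even, Nat.div2_double; reflexivity. }
  replace (fun n => if Nat.even (S (2 * n)) then E (Nat.div2 (S (2 * n)))
                    else F (Nat.div2 (S (2 * n)))) with F.
  2:{ apply functional_extensionality; intros n.
      rewrite Nat.even_succ, <- Nat.negb_even, Nat.even_even, Nat.div2_succ_double; reflexivity. }
  rewrite H, K; tauto.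
Qed.

Lemma DP_all (P : env -> V -> Prop) :
  DP (fun e => P (fun n => e (S n)) (e 0)) -> DP (fun e => forall x, P e x).
Proof.
  intros [phi [E H]]; exists (f_all phi), E; intros e; simpl.
  split; intros K x; apply (H (scons x e)), K.
Qed.

Lemma DP_or P Q : DP P -> DP Q -> DP (fun e => P e \/ Q e).
Proof.
  intros H K; apply DP_iff with (fun e => ~ (~ P e /\ ~ Q e)).
  - intros e; tauto.
  - apply DP_neg, DP_and; apply DP_neg; assumption.
Qed.

Lemma DP_imp P Q : DP P -> DP Q -> DP (fun e => P e -> Q e).
Proof.
  intros H K; apply DP_iff with (fun e => ~ (P e /\ ~ Q e)).
  - intros e; tauto.
  - apply DP_neg, DP_and; [|apply DP_neg]; assumption.
Qed.

Lemma DP_equiv P Q : DP P -> DP Q -> DP (fun e => P e <-> Q e).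
Proof. intros H K; apply DP_and; apply DP_imp; assumption. Qed.

Lemma DP_ex (P : env -> V -> Prop) :
  DP (fun e => P (fun n => e (S n)) (e 0)) -> DP (fun e => exists x, P e x).
Proof.
  intros H; apply DP_iff with (fun e => ~ forall x, ~ P e x).
  - intros e; split; [intros [x Hx] K; exact (K x Hx) |].
    intros K; apply NNPP; intros L; apply K; intros x Hx; apply L; eauto.
  - apply DP_neg, DP_all with (P := fun e x => ~ P e x), DP_neg; assumption.
Qed.

Lemma DP_ren r P : DP P -> DP (fun e => P (fun n => e (r n))).
Proof.
  intros [phi [E H]]; exists (vren r phi), E; intros e; rewrite sat_vren; apply H.
Qed.

(** Formulas have no terms, so a defined function is substituted through its graph: a bound variable
    is introduced for the value of [t]. *)
Lemma DP_let (P : env -> V -> Prop) t :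
  DF t -> DP (fun e => P (fun n => e (S n)) (e 0)) -> DP (fun e => P e (t e)).
Proof.
  intros H K; apply DP_iff with (fun e => exists x, x = t e /\ P e x).
  - intros e; split; [eauto | intros [x [-> Hx]]; exact Hx].
  - apply DP_ex with (P := fun e x => x = t e /\ P e x), DP_and; assumption.
Qed.

Lemma DP_let_r (P : env -> V -> Prop) t r :
  DF t -> DP (fun e => P (fun n => e (S n)) (e 0)) ->
  DP (fun e => P e (t (fun n => e (r n)))).
Proof.
  intros H K; apply (@DP_let P (fun e => t (fun n => e (r n)))); [|exact K].
  exact (DP_ren (upr r) H).
Qed.

Lemma DP_sub1 (R : V -> Prop) t :
  DP (fun e => R (e 0)) -> DF t -> DP (fun e => R (t e)).
Proof. intros H K; apply (DP_let (fun _ x => R x) K); exact H. Qed.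

Lemma DP_sub2 (R : V -> V -> Prop) s t :
  DP (fun e => R (e 1) (e 0)) -> DF s -> DF t -> DP (fun e => R (s e) (t e)).
Proof.
  intros H Hs Ht; apply (DP_let (fun e x => R (s e) x) Ht).
  apply (@DP_let_r (fun e x => R x (e 0)) s S Hs).
  exact (DP_ren (fun n => match n with 0 => 1 | S _ => 0 end) H).
Qed.

Lemma DP_sub3 (R : V -> V -> V -> Prop) s t u :
  DP (fun e => R (e 2) (e 1) (e 0)) -> DF s -> DF t -> DF u ->
  DP (fun e => R (s e) (t e) (u e)).
Proof.
  intros H Hs Ht Hu; apply (DP_let (fun e x => R (s e) (t e) x) Hu).
  apply (@DP_let_r (fun e x => R (s (fun n => e (S n))) x (e 0)) t S Ht).
  apply (@DP_let_r (fun e x => R x (e 0) (e 1)) s (fun n => S (S n)) Hs).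
  exact (DP_ren (fun n => match n with 0 => 2 | 1 => 1 | S _ => 0 end) H).
Qed.

Lemma DP_sub4 (R : V -> V -> V -> V -> Prop) s t u w :
  DP (fun e => R (e 3) (e 2) (e 1) (e 0)) -> DF s -> DF t -> DF u -> DF w ->
  DP (fun e => R (s e) (t e) (u e) (w e)).
Proof.
  intros H Hs Ht Hu Hw; apply (DP_let (fun e x => R (s e) (t e) (u e) x) Hw).
  apply (@DP_let_r (fun e x => R (s (fun n => e (S n))) (t (fun n => e (S n))) x (e 0)) u S Hu).
  apply (@DP_let_r (fun e x => R (s (fun n => e (S (S n)))) x (e 0) (e 1)) t
    (fun n => S (S n)) Ht).
  apply (@DP_let_r (fun e x => R x (e 0) (e 1) (e 2)) s (fun n => S (S (S n))) Hs).
  exact (DP_ren (fun n => match n with 3 => 0 | 2 => 1 | 1 => 2 | _ => 3 end) H).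
Qed.

Context {hM : GBC M}.

Lemma class_inh : inhabited (vclass M).
Proof. destruct (gbc_global_choice hM) as [C _]; exact (inhabits C). Qed.

Lemma set_inh : inhabited V.
Proof. destruct (gbc_infinity hM) as [w _]; exact (inhabits w). Qed.

Lemma DP_fml phi : DP (fun e => sat e (fun _ => epsilon class_inh (fun _ => True)) phi).
Proof. eexists phi, _; intros e; reflexivity. Qed.

Lemma DF_var i : DF (fun e => e i).
Proof. exact (DP_fml (f_eq 0 (S i))). Qed.

Lemma DP_eq s t : DF s -> DF t -> DP (fun e => s e = t e).
Proof. apply (DP_sub2 eq); exact (DP_fml (f_eq 1 0)). Qed.

Lemma DP_mem s t : DF s -> DF t -> DP (fun e => s e ∈ t e).
Proof. apply (DP_sub2 mem); exact (DP_fml (f_mem 1 0)). Qed.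

Lemma DP_cmem X t : DF t -> DP (fun e => t e ∈c X).
Proof.
  apply (@DP_sub1 (fun x => x ∈c X)); exists (f_cmem 0 0), (fun _ => X); intros e; reflexivity.
Qed.

Lemma class_of P : DP P -> forall e, D1 (fun x => P (scons x e)).
Proof.
  intros [phi [E H]] e; destruct (gbc_comprehension hM phi e E) as [X K].
  exists X; intros x; rewrite K; apply H.
Qed.

(** The parameters of a defining formula are classes only, so the set [a] enters through the class
    {a}. *)
Lemma DF_const a : DF (fun _ => a).
Proof.
  destruct (class_of (DP_fml (f_eq 0 1)) (fun _ => a)) as [X H].
  apply DP_iff with (fun e => e 0 ∈c X); [|apply DP_cmem, DF_var].
  intros e; exact (H (e 0)).
Qed.

Lemma D1_of P : DP (fun e => P (e 0)) -> D1 P.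
Proof.
  intros H; exact (class_of H (fun _ => epsilon set_inh (fun _ => True))).
Qed.

Lemma DP_D1 P t : D1 P -> DF t -> DP (fun e => P (t e)).
Proof.
  intros [X H] Ht; apply DP_iff with (fun e => t e ∈c X).
  - intros e; apply H.
  - apply DP_cmem, Ht.
Qed.

(** A proposition not depending on the environment is true or false outright, so a trivial formula
    expresses it. *)
Lemma DP_const (P : Prop) : DP (fun _ => P).
Proof.
  destruct (classic P).
  - apply DP_iff with (fun e => e 0 = e 0); [tauto | apply DP_eq; apply DF_var].
  - apply DP_iff with (fun e => ~ e 0 = e 0); [tauto | apply DP_neg, DP_eq; apply DF_var].
Qed.

Definition is_setof (P : V -> Prop) (b : V) : Prop := forall x, x ∈ b <-> P x.

Definition small (P : V -> Prop) : Prop := exists b, is_setof P b.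

(** The value is empty if the extension of [P] is not a set. *)
Definition setof (P : V -> Prop) : V :=
  epsilon set_inh (fun b => is_setof P b \/ ~ small P /\ forall x, ~ x ∈ b).

Lemma ext (x y : V) : (forall z, z ∈ x <-> z ∈ y) -> x = y.
Proof. apply (gbc_set_ext hM). Qed.

Lemma opair_inj (p x y z t : V) : is_opair p x y -> is_opair p z t -> x = z /\ y = t.
Proof.
  intros [u [v [Hu [Hv Hp]]]] [u' [v' [Hu' [Hv' Hp']]]].
  assert (x = z).
  { assert (Q1 : u = u' \/ u = v') by (apply Hp', Hp; auto).
    destruct Q1 as [-> | ->].
    - assert (x = z \/ x = z) by (apply Hu', Hu; auto); tauto.
    - assert (z = x \/ z = x) by (apply Hu, Hv'; auto); intuition. }
  subst z; split; [reflexivity|].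
  assert (u = u') as <- by (apply ext; intros w; rewrite (Hu w), (Hu' w); tauto).
  assert (Q1 : v = u \/ v = v') by (apply Hp', Hp; auto).
  assert (Q2 : v' = u \/ v' = v) by (apply Hp, Hp'; auto).
  destruct Q1 as [-> | ->].
  - assert (y = x) as -> by (assert (y = x \/ y = x) by (apply Hu, Hv; auto); tauto).
    destruct Q2 as [-> | ->];
    (assert (t = x \/ t = x) by (apply Hu, Hv'; auto); intuition).
  - assert (y = x \/ y = t) by (apply Hv', Hv; auto).
    assert (t = x \/ t = y) by (apply Hv, Hv'; auto).
    intuition congruence.
Qed.

(** Separation is replacement along a partial identity, the class of pairs <x, x> with [x] in the
    class of [Q]. *)
Lemma small_D1 P Q : D1 Q -> small P -> (forall x, Q x -> P x) -> small Q.
Proof.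
  intros [X HX] [b Hb] H.
  assert (K : D1 (fun p => exists x, is_opair p x x /\ x ∈c X)).
  { apply D1_of, DP_ex, DP_and; [|apply DP_cmem, DF_var].
    apply DP_ex, DP_ex; repeat apply DP_and; apply DP_all;
      (apply DP_equiv; [apply DP_mem | apply DP_or; apply DP_eq]); apply DF_var. }
  destruct K as [F HF].
  destruct (@gbc_replacement M hM F) with (a := b) as [c Hc].
  - intros x y z [p [Hp Kp]] [q [Hq Kq]]; apply HF in Kp, Kq.
    destruct Kp as [x1 [Kp _]], Kq as [x2 [Kq _]].
    destruct (opair_inj Hp Kp), (opair_inj Hq Kq); congruence.
  - exists c; intros y; rewrite Hc; split.
    + intros [x [_ [p [Hp Kp]]]]; apply HF in Kp; destruct Kp as [x1 [Kp L]].
      destruct (opair_inj Hp Kp) as [-> ->]; apply HX, L.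
    + intros Hy; exists y; split; [apply Hb, H, Hy|].
      destruct (gbc_pairing hM y y) as [u Hu], (gbc_pairing hM u u) as [p Hp].
      assert (is_opair p y y) by (exists u, u; auto).
      exists p; split; [assumption|]; apply HF; exists y; split; [assumption|].
      apply HX, Hy.
Qed.

Lemma in_setof P x : small P -> (x ∈ setof P <-> P x).
Proof.
  intros [b Hb].
  assert (N : is_setof P (setof P) \/ ~ small P /\ forall x, ~ x ∈ setof P).
  { unfold setof; apply epsilon_spec; exists b; auto. }
  destruct N as [N | [N _]]; [apply N | destruct N; exists b; exact Hb].
Qed.

(** Fixing the default value makes the graph definable: [y] is the value iff [y] has the extension
    [P], or no set has it and [y] is empty. *)
Lemma DF_setof (P : env -> V -> Prop) :
  DP (fun e => P (fun n => e (S n)) (e 0)) -> DF (fun e => setof (P e)).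
Proof.
  intros H.
  apply DP_iff with (fun e => is_setof (P (fun n => e (S n))) (e 0) \/
    ~ small (P (fun n => e (S n))) /\ forall x, ~ x ∈ e 0).
  - intros e; set (Q := P (fun n => e (S n))); apply and_comm; split.
    + intros [K | [K L]]; apply ext; intros x.
      * rewrite in_setof; [apply K | exists (e 0); exact K].
      * assert (N : is_setof Q (setof Q) \/ ~ small Q /\ forall x, ~ x ∈ setof Q).
        { unfold setof; apply epsilon_spec; exists (e 0); right; auto. }
        destruct N as [N | [_ N]]; [destruct K; eexists; exact N|].
        split; intros Z; [destruct (L x Z) | destruct (N x Z)].
    + intros ->; unfold setof; apply epsilon_spec.
      destruct (classic (small Q)) as [[b Hb]|K]; [exists b; auto|].
      destruct (gbc_infinity hM) as [w [[z [_ Hz]] _]].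
      exists z; right; split; auto.
  - apply DP_or.
    + apply DP_all, DP_equiv; [apply DP_mem; apply DF_var|].
      exact (DP_ren (fun n => match n with 0 => 0 | S n => S (S n) end) H).
    + apply DP_and; [apply DP_neg, DP_ex, DP_all, DP_equiv|].
      * apply DP_mem; apply DF_var.
      * exact (DP_ren (fun n => match n with 0 => 0 | S n => S (S (S n)) end) H).
      * apply DP_all, DP_neg, DP_mem; apply DF_var.
Qed.

Lemma DF_if (c : env -> Prop) s t : DP c -> DF s -> DF t ->
  DF (fun e => if excluded_middle_informative (c e) then s e else t e).
Proof.
  intros Hc Hs Ht; apply DP_iff with (fun e =>
    (c (fun n => e (S n)) /\ e 0 = s (fun n => e (S n))) \/
    (~ c (fun n => e (S n)) /\ e 0 = t (fun n => e (S n)))).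
  - intros e; destruct excluded_middle_informative; tauto.
  - apply DP_or; apply DP_and; try assumption; [|apply DP_neg];
      exact (DP_ren S Hc).
Qed.

End Definability.

(** * Sets *)

(** Definability goals are solved by syntax-directed search. The hooks fail at first and are
    redefined as new notions receive definability lemmas, so that the search can treat these notions
    as primitive. *)
Ltac dp_sets := fail.
Ltac dp_finite := fail.
Ltac dp_forcing := fail.
Ltac dp_names := fail.
Ltac dp_local := fail.
Ltac dp_step := cbv beta; first
  [ assumption
  | simple apply DP_const | simple apply DF_const | simple apply DF_var
  | dp_local | dp_names | dp_forcing | dp_finite | dp_sets
  | simple apply DP_eq | simple apply DP_mem | simple apply DP_cmem
  | simple apply DP_and | simple apply DP_or | simple apply DP_equiv
  | simple apply DP_neg | simple apply DP_imp | simple apply DP_ex | simple apply DP_all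
  | simple apply DF_setof | simple apply DF_if
  | progress unfold is_upair, is_opair, is_empty, subset, is_succ, inductive_set ].
Ltac dp := repeat dp_step.

Section Sets.
Context {M : structure} {hM : GBC M}.
Notation V := (vset M).

Definition emp : V := setof (fun _ => False).
Definition up (x y : V) : V := setof (fun z => z = x \/ z = y).
Definition sgl (x : V) : V := up x x.
Definition pr (x y : V) : V := up (up x x) (up x y).
Definition uni (a : V) : V := setof (fun z => exists y, y ∈ a /\ z ∈ y).
Definition cup (a b : V) : V := setof (fun z => z ∈ a \/ z ∈ b).

Lemma in_emp x : x ∈ emp <-> False.
Proof.
  apply (in_setof (P := fun _ => False)); destruct (gbc_infinity hM) as [w [[z [_ H]] _]].
  exists z; intros y; specialize (H y); tauto.
Qed.

Lemma in_up x y z : z ∈ up x y <-> z = x \/ z = y.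
Proof.
  apply (in_setof (P := fun z => z = x \/ z = y)); destruct (gbc_pairing hM x y) as [p H].
  exists p; exact H.
Qed.

Lemma in_sgl x y : y ∈ sgl x <-> y = x.
Proof. unfold sgl; rewrite in_up; tauto. Qed.

Lemma in_uni a z : z ∈ uni a <-> exists y, y ∈ a /\ z ∈ y.
Proof.
  apply (in_setof (P := fun z => exists y, y ∈ a /\ z ∈ y)).
  destruct (gbc_union hM a) as [p H]; exists p; exact H.
Qed.

Lemma in_cup a b z : z ∈ cup a b <-> z ∈ a \/ z ∈ b.
Proof.
  apply (in_setof (P := fun z => z ∈ a \/ z ∈ b)).
  exists (uni (up a b)); intros x; rewrite in_uni; split.
  - intros [y [H K]]; apply in_up in H; destruct H; subst; auto.
  - intros [H|H]; eexists; rewrite in_up; eauto.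
Qed.

Lemma upair_iff p x y : is_upair p x y <-> p = up x y.
Proof.
  split; [intros H; apply ext; intros z; rewrite in_up; apply H|].
  intros ->; intros z; apply in_up.
Qed.

Lemma opair_iff p x y : is_opair p x y <-> p = pr x y.
Proof.
  unfold is_opair, pr; split.
  - intros [u [v [Hu [Hv Hp]]]]; rewrite upair_iff in *; congruence.
  - intros ->; exists (up x x), (up x y); rewrite !upair_iff; auto.
Qed.

Lemma pr_inj x y z t : pr x y = pr z t -> x = z /\ y = t.
Proof. intros H; apply (@opair_inj M hM (pr x y)); apply opair_iff; auto. Qed.

Lemma rel_iff R x y : rel R x y <-> pr x y ∈ R.
Proof.
  split; [intros [p [H K]]; apply opair_iff in H; congruence|].
  intros H; exists (pr x y); rewrite opair_iff; auto.
Qed.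

Lemma crel_iff R x y : crel R x y <-> pr x y ∈c R.
Proof.
  split; [intros [p [H K]]; apply opair_iff in H; congruence|].
  intros H; exists (pr x y); rewrite opair_iff; auto.
Qed.

Lemma DF_ren r (t : (nat -> V) -> V) : DF t -> DF (fun e => t (fun n => e (r n))).
Proof. intros H; exact (DP_ren (upr r) H). Qed.

Lemma DF_sub1 (f : V -> V) (t : (nat -> V) -> V) : DF (fun e => f (e 0)) -> DF t -> DF (fun e => f (t e)).
Proof.
  intros H Ht; apply (@DP_sub2 M (fun z x => z = f x)); [|exact (DF_var 0)|exact (DF_ren S Ht)].
  exact (DP_ren (fun n => match n with 0 => 1 | _ => 0 end) H).
Qed.

Lemma DF_sub2 (f : V -> V -> V) (s t : (nat -> V) -> V) : DF (fun e => f (e 1) (e 0)) -> DF s -> DF t ->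
  DF (fun e => f (s e) (t e)).
Proof.
  intros H Hs Ht; apply (@DP_sub3 M (fun z x y => z = f x y));
    [|exact (DF_var 0)|exact (DF_ren S Hs)|exact (DF_ren S Ht)].
  exact (DP_ren (fun n => match n with 0 => 2 | 1 => 0 | _ => 1 end) H).
Qed.

Lemma DF_sub3 (f : V -> V -> V -> V) (s t u : (nat -> V) -> V) : DF (fun e => f (e 2) (e 1) (e 0)) ->
  DF s -> DF t -> DF u -> DF (fun e => f (s e) (t e) (u e)).
Proof.
  intros H Hs Ht Hu; apply (@DP_sub4 M (fun z x y w => z = f x y w));
    [|exact (DF_var 0)|exact (DF_ren S Hs)|exact (DF_ren S Ht)|exact (DF_ren S Hu)].
  exact (DP_ren (fun n => match n with 0 => 3 | 1 => 0 | 2 => 1 | _ => 2 end) H).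
Qed.

Lemma D2_of (R : V -> V -> Prop) : DP (fun e => R (e 1) (e 0)) -> D2 R.
Proof.
  intros H.
  assert (K : D1 (fun p => exists x y, is_opair p x y /\ R x y)).
  { apply D1_of; dp. }
  destruct K as [X HX]; exists X; intros x y; rewrite crel_iff, <- HX; split.
  - intros L; exists x, y; rewrite opair_iff; auto.
  - intros [x' [y' [L K]]]; apply opair_iff, pr_inj in L; destruct L; subst; exact K.
Qed.

Lemma DP_D2 (R : V -> V -> Prop) s t : D2 R -> DF s -> DF t -> DP (fun e => R (s e) (t e)).
Proof.
  intros [X H]; apply DP_sub2.
  apply DP_iff with (fun e => crel X (e 1) (e 0)); [intros e; apply H | unfold crel; dp].
Qed.

Lemma DF_D2 (f : V -> V) t : D2 (fun x y => y = f x) -> DF t -> DF (fun e => f (t e)).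
Proof.
  intros H; apply DF_sub1; exact (DP_D2 H (DF_var 1) (DF_var 0)).
Qed.

Lemma DF_up (s t : (nat -> V) -> V) : DF s -> DF t -> DF (fun e => up (s e) (t e)).
Proof. apply DF_sub2; unfold up; dp. Qed.

Lemma DF_pr (s t : (nat -> V) -> V) : DF s -> DF t -> DF (fun e => pr (s e) (t e)).
Proof. intros; unfold pr; repeat apply DF_up; assumption. Qed.

Lemma DF_cup (s t : (nat -> V) -> V) : DF s -> DF t -> DF (fun e => cup (s e) (t e)).
Proof. apply DF_sub2; unfold cup; dp. Qed.

Lemma DF_uni (s : (nat -> V) -> V) : DF s -> DF (fun e => uni (s e)).
Proof. apply DF_sub1; unfold uni; dp. Qed.

Lemma DP_rel (r s t : (nat -> V) -> V) : DF r -> DF s -> DF t -> DP (fun e => rel (r e) (s e) (t e)).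
Proof. apply DP_sub3; unfold rel; dp. Qed.

Lemma DP_crel X (s t : (nat -> V) -> V) : DF s -> DF t -> DP (fun e => crel X (s e) (t e)).
Proof. apply (@DP_sub2 M (crel X)); unfold crel; dp. Qed.

Lemma DP_crel3 X (r s t : (nat -> V) -> V) : DF r -> DF s -> DF t -> DP (fun e => crel3 X (r e) (s e) (t e)).
Proof. apply (@DP_sub3 M (crel3 X)); unfold crel3, crel; dp. Qed.

Lemma DF_sgl (t : (nat -> V) -> V) : DF t -> DF (fun e => sgl (t e)).
Proof. intros; apply DF_up; assumption. Qed.

Definition img (f : V -> V) (a : V) : V := setof (fun y => exists x, x ∈ a /\ y = f x).

Lemma small_img (R : V -> V -> Prop) a : D2 R ->
  (forall x y z, R x y -> R x z -> y = z) -> small (fun y => exists x, x ∈ a /\ R x y).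
Proof.
  intros [F HF] H; destruct (@gbc_replacement M hM F) with (a := a) as [b Hb].
  - intros x y z; rewrite <- !HF; apply H.
  - exists b; intros y; rewrite Hb; split; intros [x [Hx K]]; exists x; apply HF in K; auto.
Qed.

Lemma in_img (f : V -> V) a y : D2 (fun x y => y = f x) -> (y ∈ img f a <-> exists x, x ∈ a /\ y = f x).
Proof.
  intros H; apply (in_setof (P := fun y => exists x, x ∈ a /\ y = f x)).
  apply (small_img a H); congruence.
Qed.

Lemma DF_img (f : (nat -> V) -> V -> V) t :
  DF (fun e => f (fun n => e (S n)) (e 0)) -> DF t -> DF (fun e => img (f e) (t e)).
Proof.
  intros H Ht; unfold img; apply DF_setof, DP_ex, DP_and.
  - apply DP_mem; [dp | exact (DF_ren (fun n => S (S n)) Ht)].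
  - apply DP_eq; [dp|].
    exact (DF_ren (fun n => match n with 0 => 0 | S n => S (S n) end) H).
Qed.

Definition sep (a : V) (P : V -> Prop) : V := setof (fun x => x ∈ a /\ P x).

Lemma in_sep a (P : V -> Prop) x : D1 P -> (x ∈ sep a P <-> x ∈ a /\ P x).
Proof.
  intros H; apply (in_setof (P := fun x => x ∈ a /\ P x)).
  destruct H as [X HX]; apply small_D1 with (fun x => x ∈ a).
  - apply D1_of; apply DP_and; [dp|]; apply DP_D1; [exists X; exact HX | dp].
  - exists a; intros y; reflexivity.
  - tauto.
Qed.

Lemma DF_sep (P : (nat -> V) -> V -> Prop) (t : (nat -> V) -> V) :
  DF t -> DP (fun e => P (fun n => e (S n)) (e 0)) -> DF (fun e => sep (t e) (P e)).
Proof.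
  intros Ht H; unfold sep; apply DF_setof, DP_and; [|exact H].
  apply DP_mem; [dp | exact (DF_ren S Ht)].
Qed.

Lemma small_sub (P : V -> Prop) a : D1 P -> (forall x, P x -> x ∈ a) -> small P.
Proof.
  intros H K; apply small_D1 with (fun x => x ∈ a); auto; exists a; intros x; reflexivity.
Qed.

End Sets.

Ltac dp_sets ::= first
  [ simple apply DF_pr | simple apply DF_up | simple apply DF_cup | simple apply DF_uni
  | simple apply DF_sgl | simple apply DF_sep | simple apply DF_img
  | simple apply DP_rel | simple apply DP_crel | simple apply DP_crel3
  | match goal with
    | H : @D1 _ _ |- _ => apply (DP_D1 H)
    | H : @D2 _ _ |- _ => first [apply (DF_D2 _ H) | apply (DP_D2 H)]
    end ].
Ltac d1 := apply D1_of; dp.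
Ltac d2 := apply D2_of; dp.
Ltac by_ind H := match goal with |- forall k, @?Q k => refine (H Q _ _); [d1|] end.
Ltac by_ind2 H :=
  match goal with |- forall k, _ -> @?Q k => refine (H Q _ _ _); [try (d1; fail)| |] end.

(** * Foundation and a form of collection *)

Section Sets2.
Context {M : structure} {hM : GBC M}.
Notation V := (vset M).

Lemma in_induction (P : V -> Prop) : D1 P ->
  (forall x, (forall y, y ∈ x -> P y) -> P x) -> forall x, P x.
Proof.
  intros H K x; apply NNPP; intros L.
  assert (D : D1 (fun x => ~ P x)) by d1.
  destruct D as [X HX], (@gbc_foundation M hM X) as [y [Hy Ky]].
  - exists x; apply HX, L.
  - apply HX in Hy; apply Hy, K; intros z Hz; apply NNPP; intros N; apply (Ky z Hz), HX, N.
Qed.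

Lemma no_self (x : V) : ~ x ∈ x.
Proof.
  revert x; apply in_induction; [d1|]; intros x H K; exact (H x K K).
Qed.

(** The depths occurring here cover the components of Kuratowski pairs and of
    the codes of formulas. *)
Lemma deep_induction (P : V -> Prop) : D1 P ->
  (forall x, (forall y, y ∈ x -> forall z, z ∈ y -> P z /\
     forall t, t ∈ z -> P t /\ forall r, r ∈ t -> P r) -> P x) -> forall x, P x.
Proof.
  intros H K x.
  enough (Q : forall x, P x /\ forall y, y ∈ x -> P y /\ forall z, z ∈ y -> P z /\
    forall t, t ∈ z -> P t) by apply Q.
  apply in_induction; [d1|].
  clear x; intros x L; split.
  2:{ intros y Hy; destruct (L y Hy) as [Py L1]; split; [exact Py|]; intros z Hz.
      destruct (L1 z Hz) as [Pz L2]; split; [exact Pz|]; intros t Ht; exact (proj1 (L2 t Ht)). }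
  apply K; intros y Hy z Hz; destruct (L y Hy) as [_ L1], (L1 z Hz) as [Pz L2].
  split; [exact Pz|]; intros t Ht; destruct (L2 t Ht); auto.
Qed.

Lemma pr_left x y : exists z, z ∈ pr x y /\ x ∈ z.
Proof. exists (up x x); unfold pr; rewrite !in_up; auto. Qed.

Lemma pr_right x y : exists z, z ∈ pr x y /\ y ∈ z.
Proof. exists (up x y); unfold pr; rewrite !in_up; auto. Qed.

(** Replacement needs a unique witness for each [x]. The intersection of all witnesses is canonical,
    and the last hypothesis makes it a witness again. *)
Lemma collect_min (I : V -> V -> Prop) (S : V) : D2 I ->
  (forall x, x ∈ S -> exists D, I x D) ->
  (forall x D, x ∈ S -> I x D -> forall D0,
     (forall z, z ∈ D0 <-> forall D', I x D' -> z ∈ D') -> I x D0) ->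
  exists W, (forall x, x ∈ S -> exists D, D ∈ W /\ I x D) /\
    forall D, D ∈ W -> exists x, x ∈ S /\ I x D.
Proof.
  intros HI H K.
  set (J := fun x D0 => I x D0 /\ forall z, z ∈ D0 <-> forall D', I x D' -> z ∈ D').
  assert (HJ : D2 J) by (unfold J; d2).
  destruct (small_img S HJ) as [W HW].
  - intros x y z [_ L] [_ N]; apply ext; intros t; rewrite L, N; reflexivity.
  - exists W; split.
    + intros x Hx; destruct (H x Hx) as [D HD].
      assert (L : small (fun z => forall D', I x D' -> z ∈ D')).
      { apply (@small_sub M hM _ D); [d1 | auto]. }
      destruct L as [D0 L]; exists D0; assert (I x D0) by (eapply K; eauto).
      split; [apply HW; exists x; split; [|split]; auto | auto].
    + intros D HD; apply HW in HD; destruct HD as [x [Hx [L _]]]; eauto.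
Qed.

End Sets2.

(** * Recursion *)

Section Recursion.
Context {M : structure} {hM : GBC M}.
Notation V := (vset M).

Definition restr (f K : V) : V := sep f (fun p => exists k y, k ∈ K /\ p = pr k y).

Lemma in_restr f K p : p ∈ restr f K <-> p ∈ f /\ exists k y, k ∈ K /\ p = pr k y.
Proof. unfold restr; rewrite in_sep by d1; reflexivity. Qed.

Lemma DF_restr (s t : (nat -> V) -> V) : DF s -> DF t -> DF (fun e => restr (s e) (t e)).
Proof. apply DF_sub2; unfold restr; apply DF_sep; dp. Qed.

Context (kids : V -> V) (kids_def : D2 (fun k K => K = kids k)).
Context (kids_ind : forall Q : V -> Prop, D1 Q ->
  (forall k, (forall i, i ∈ kids k -> Q i) -> Q k) -> forall k, Q k).
Context (G : V -> V -> V) (G_def : DF (fun e => G (e 1) (e 0))).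

Ltac dp_local ::= first [simple apply DF_restr | apply (DF_sub2 G G_def)].

(** Attempts at the recursion: partial solutions whose domain is closed under [kids].
    Single-valuedness is not demanded; it follows from the uniqueness below, applied to one attempt
    twice. *)
Let att (f : V) : Prop := forall k y, pr k y ∈ f ->
  (forall i, i ∈ kids k -> exists z, pr i z ∈ f) /\ y = G k (restr f (kids k)).

Let att_def : D1 att.
Proof. unfold att; d1. Qed.

Let restr_eq k f f' :
  (forall i y, i ∈ kids k -> (pr i y ∈ f <-> pr i y ∈ f')) ->
  restr f (kids k) = restr f' (kids k).
Proof.
  intros H; apply ext; intros p; rewrite !in_restr; split; intros [K [i [y [Hi ->]]]];
    (split; [apply (H i y Hi), K | eauto]).
Qed.

Let att_unique k : forall f f' y y', att f -> att f' -> pr k y ∈ f -> pr k y' ∈ f' -> y = y'.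
Proof.
  revert k; by_ind kids_ind; intros k IH f f' y y' Hf Hf' Hy Hy'.
  destruct (Hf _ _ Hy) as [Kf ->], (Hf' _ _ Hy') as [Kf' ->]; f_equal.
  apply restr_eq; intros i z Hi.
  destruct (Kf i Hi) as [z1 H1], (Kf' i Hi) as [z2 H2].
  split; intros H3.
  - rewrite (IH i Hi f f' z z2); auto.
  - rewrite (IH i Hi f' f z z1); auto.
Qed.

(** Attempts for the children are glued together, and [k] is added. To collect one attempt per
    child, the intersection of all attempts defined there is taken; it is an attempt because
    attempts agree wherever they are defined. *)
Let att_exists k : exists f, att f /\ exists y, pr k y ∈ f.
Proof.
  revert k; by_ind kids_ind; intros k IH.
  destruct (@collect_min M hM (fun i f => att f /\ exists y, pr i y ∈ f) (kids k))
    as [W [HW HW']]; [d2|exact IH| |].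
  - intros i D Hi [HD [y Hy]] D0 H0; split.
    + intros j z Hz; assert (Hz' := Hz); apply H0 with (D' := D) in Hz'; [|eauto].
      destruct (HD _ _ Hz') as [L ->].
      assert (Q : forall i, i ∈ kids j -> exists z, pr i z ∈ D0).
      { intros j' Hj'; destruct (L _ Hj') as [z' Lz]; exists z'; apply H0.
        intros D' [HD' [y' Hy']].
        assert (N := Hz); apply H0 with (D' := D') in N; [|eauto].
        destruct (HD' _ _ N) as [N' _], (N' _ Hj') as [z2 N2].
        rewrite (@att_unique _ _ _ _ _ HD HD' Lz N2); exact N2. }
      split; [exact Q|]; f_equal; apply restr_eq; intros i' z' Hi'; split.
      * intros Lz; destruct (Q _ Hi') as [z2 N2].
        assert (N3 := N2); apply H0 with (D' := D) in N3; [|eauto].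
        rewrite (@att_unique _ _ _ _ _ HD HD Lz N3); exact N2.
      * intros N; apply H0 with (D' := D) in N; eauto.
    + exists y; apply H0; intros D' [HD' [y' Hy']].
      rewrite (@att_unique _ _ _ _ _ HD HD' Hy Hy'); exact Hy'.
  - set (U := uni W).
    assert (AU : forall D, D ∈ W -> att D) by (intros D HD; apply HW' in HD; destruct HD as [i [_ [HD _]]]; exact HD).
    assert (HU : att U).
    { intros j z Hz; apply in_uni in Hz; destruct Hz as [D [HD Hz]].
      destruct (AU D HD _ _ Hz) as [L ->].
      assert (Q : forall i, i ∈ kids j -> exists z, pr i z ∈ D /\ pr i z ∈ U).
      { intros i Hi; destruct (L i Hi) as [z' Hz']; exists z'.
        split; [|apply in_uni]; eauto. }
      split; [intros i Hi; destruct (Q i Hi) as [? []]; eauto|].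
      f_equal; apply restr_eq; intros i z' Hi; split; intros Hz'; [apply in_uni; eauto|].
      apply in_uni in Hz'; destruct Hz' as [D' [HD' Hz']], (Q i Hi) as [z2 [H2 _]].
      rewrite (@att_unique _ _ _ _ _ (AU _ HD') (AU _ HD) Hz' H2); exact H2. }
    assert (KU : forall i, i ∈ kids k -> exists z, pr i z ∈ U).
    { intros i Hi; destruct (HW i Hi) as [D [HD [_ [z Hz]]]]; exists z; apply in_uni; eauto. }
    (* If [k] is new, adding it alters no relevant restriction: the children concerned are already
       in the domain of [U], hence different from [k]. *)
    destruct (classic (exists y, pr k y ∈ U)) as [Hk | Hk]; [eauto|].
    set (y := G k (restr U (kids k))).
    set (f := cup U (up (pr k y) (pr k y))).
    assert (Hf : forall i z, pr i z ∈ f <-> pr i z ∈ U \/ i = k /\ z = y).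
    { intros i z; unfold f; rewrite in_cup, in_up; split; [|intuition congruence].
      intros [H | [H | H]]; auto; apply pr_inj in H; auto. }
    assert (Hr : forall j, (forall i, i ∈ kids j -> exists z, pr i z ∈ U) ->
      restr U (kids j) = restr f (kids j)).
    { intros j Hj; apply restr_eq; intros i z Hi; rewrite Hf; split; [auto|].
      intros [H | [-> _]]; [exact H | destruct Hk; auto]. }
    exists f; split; [|exists y; apply Hf; auto].
    intros j z Hz; apply Hf in Hz.
    assert (Q : (forall i, i ∈ kids j -> exists z, pr i z ∈ U) /\
                z = G j (restr U (kids j))).
    { destruct Hz as [Hz | [-> ->]]; [exact (HU _ _ Hz) | auto]. }
    destruct Q as [Q ->]; split; [|f_equal; auto].
    intros i Hi; destruct (Q i Hi) as [z Hz']; exists z; apply Hf; auto.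
Qed.

(** The graph of the solution is a class because attempts are sets: [y] is the value at [k] iff some
    attempt contains <k, y>. The argument [img (fun i => pr i (N i)) (kids k)] is the restriction of
    the solution to the children. *)
Theorem recursion : exists N : V -> V, D2 (fun k y => y = N k) /\
  forall k, N k = G k (img (fun i => pr i (N i)) (kids k)).
Proof.
  set (R := fun k y => exists f, att f /\ pr k y ∈ f).
  assert (HR : D2 R) by (unfold R; d2).
  set (N := fun k => epsilon set_inh (R k)).
  assert (HN : forall k, R k (N k)).
  { intros k; unfold N; apply epsilon_spec; destruct (att_exists k) as [f [Hf [y Hy]]].
    exists y, f; auto. }
  assert (UN : forall k y, R k y <-> y = N k).
  { intros k y; split; [|intros ->; apply HN].
    intros [f [Hf Hy]]; destruct (HN k) as [f' [Hf' Hy']].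
    exact (@att_unique _ _ _ _ _ Hf Hf' Hy Hy'). }
  exists N; assert (D : D2 (fun k y => y = N k)).
  { destruct HR as [X HX]; exists X; intros x y; rewrite <- UN; apply HX. }
  split; [exact D|]; intros k.
  destruct (HN k) as [f [Hf Hy]], (Hf _ _ Hy) as [L E]; rewrite E; f_equal.
  apply ext; intros p; rewrite in_restr, in_img by d2; split.
  - intros [Hp [i [y [Hi ->]]]]; exists i; split; [exact Hi|].
    f_equal; apply UN; exists f; auto.
  - intros [i [Hi ->]]; destruct (L i Hi) as [z Hz].
    assert (z = N i) as <- by (apply UN; exists f; auto); eauto.
Qed.

End Recursion.

(** * Natural numbers and finite sets *)

Section Naturals.
Context {M : structure} {hM : GBC M}.
Notation V := (vset M).

Definition suc (x : V) : V := cup x (up x x).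
Definition om : V := setof is_nat.

Lemma in_suc x y : y ∈ suc x <-> y ∈ x \/ y = x.
Proof. unfold suc; rewrite in_cup, in_up; tauto. Qed.

Lemma empty_iff (z : V) : is_empty z <-> z = emp.
Proof.
  split; [intros H; apply ext; intros y; rewrite in_emp; split; [apply H|tauto]|].
  intros -> y Hy; apply in_emp in Hy; exact Hy.
Qed.

Lemma succ_iff (s x : V) : is_succ s x <-> s = suc x.
Proof.
  split; [intros H; apply ext; intros y; rewrite in_suc; apply H|].
  intros ->; intros y; apply in_suc.
Qed.

Lemma inductive_iff (w : V) :
  inductive_set w <-> emp ∈ w /\ forall x, x ∈ w -> suc x ∈ w.
Proof.
  unfold inductive_set; split.
  - intros [[z [H K]] L]; apply empty_iff in K; subst z; split; [exact H|].
    intros x Hx; destruct (L x Hx) as [s [Hs E]]; apply succ_iff in E; congruence.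
  - intros [H K]; split; [exists emp; rewrite empty_iff; auto|].
    intros x Hx; exists (suc x); rewrite succ_iff; auto.
Qed.

Lemma DP_is_nat (t : (nat -> V) -> V) : DF t -> DP (fun e => is_nat (t e)).
Proof. apply DP_sub1; unfold is_nat; dp. Qed.

Lemma nat_zero : is_nat (@emp M hM).
Proof. intros w Hw; apply inductive_iff in Hw; apply Hw. Qed.

Lemma nat_succ (n : V) : is_nat n -> is_nat (suc n).
Proof. intros H w Hw; assert (K := Hw); apply inductive_iff in K; apply K, H, Hw. Qed.

Lemma nat_induction (P : V -> Prop) : D1 P -> P emp ->
  (forall n, is_nat n -> P n -> P (suc n)) -> forall n, is_nat n -> P n.
Proof.
  intros H H0 HS n Hn; destruct (gbc_infinity hM) as [w Hw].
  assert (K : forall x, x ∈ sep w (fun n => is_nat n /\ P n) <-> x ∈ w /\ is_nat x /\ P x).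
  { intros x; rewrite in_sep; [reflexivity|]; apply D1_of, DP_and; [apply DP_is_nat|]; dp. }
  assert (L : inductive_set (sep w (fun n => is_nat n /\ P n))).
  { rewrite inductive_iff in *; split.
    - apply K; split; [apply Hw | split; [apply nat_zero | exact H0]].
    - intros x Hx; apply K in Hx; apply K; destruct Hx as [A [B C]].
      split; [apply Hw, A | split; [apply nat_succ | apply HS]; auto]. }
  apply Hn in L; apply K in L; apply L.
Qed.

Lemma in_om n : n ∈ om <-> is_nat n.
Proof.
  apply (in_setof (P := is_nat)); destruct (gbc_infinity hM) as [w Hw].
  apply (@small_sub M hM _ w); [apply D1_of, DP_is_nat; dp|].
  intros x Hx; apply Hx, Hw.
Qed.

Lemma DF_suc (t : (nat -> V) -> V) : DF t -> DF (fun e => suc (t e)).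
Proof. intros H; unfold suc; dp. Qed.

Ltac dp_local ::= first [simple apply DP_is_nat | simple apply DF_suc].

Lemma nat_trans (n : V) : is_nat n -> transitive_set n.
Proof.
  revert n; unfold transitive_set; by_ind2 (@nat_induction).
  - intros y Hy; destruct (proj1 (in_emp y) Hy).
  - intros n _ IH y Hy z Hz; rewrite in_suc in *; destruct Hy as [Hy | ->]; [|auto].
    left; exact (IH y Hy z Hz).
Qed.

Lemma nat_pos (n : V) : is_nat n -> n = emp \/ emp ∈ n.
Proof.
  revert n; by_ind2 (@nat_induction); [auto|].
  intros n _ [-> | H]; right; apply in_suc; auto.
Qed.

Lemma suc_in_suc (m n : V) : is_nat n -> m ∈ n -> suc m ∈ suc n.
Proof.
  intros Hn; revert m; revert n Hn; by_ind2 (@nat_induction).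
  - intros m Hm; destruct (proj1 (in_emp m) Hm).
  - intros n _ IH m Hm; apply in_suc in Hm; apply in_suc.
    destruct Hm as [Hm | ->]; auto.
Qed.

Lemma nat_total (n : V) : is_nat n -> forall m, is_nat m -> m ∈ n \/ m = n \/ n ∈ m.
Proof.
  revert n; by_ind2 (@nat_induction).
  - intros m Hm; destruct (nat_pos Hm); auto.
  - intros n Hn IH m Hm; rewrite in_suc; destruct (IH m Hm) as [H | [H | H]]; auto.
    apply suc_in_suc in H; [|assumption]; apply in_suc in H; intuition.
Qed.

End Naturals.

Ltac dp_finite ::= first [simple apply DP_is_nat | simple apply DF_suc].

Section Finite.
Context {M : structure} {hM : GBC M}.
Notation V := (vset M).

Lemma DP_is_function (t : (nat -> V) -> V) : DF t -> DP (fun e => is_function (t e)).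
Proof. apply DP_sub1; unfold is_function, is_relation; dp. Qed.

Lemma DP_is_injective (t : (nat -> V) -> V) : DF t -> DP (fun e => is_injective (t e)).
Proof. apply DP_sub1; unfold is_injective; dp. Qed.

Lemma DP_in_dom (s t : (nat -> V) -> V) : DF s -> DF t -> DP (fun e => in_dom (s e) (t e)).
Proof. apply DP_sub2; unfold in_dom; dp. Qed.

Lemma DP_in_ran (s t : (nat -> V) -> V) : DF s -> DF t -> DP (fun e => in_ran (s e) (t e)).
Proof. apply DP_sub2; unfold in_ran; dp. Qed.

Ltac dp_local ::= first [simple apply DP_is_function | simple apply DP_is_injective
  | simple apply DP_in_dom | simple apply DP_in_ran].

Lemma DP_is_finite (t : (nat -> V) -> V) : DF t -> DP (fun e => is_finite (t e)).
Proof. apply DP_sub1; unfold is_finite; dp. Qed.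

Lemma DP_is_coll (t : (nat -> V) -> V) : DF t -> DP (fun e => is_coll (t e)).
Proof.
  apply DP_sub1; unfold is_coll; repeat (apply DP_is_finite || dp_step).
Qed.

Definition add (f x y : V) : V := cup f (up (pr x y) (pr x y)).

Lemma rel_add f x y z t : rel (add f x y) z t <-> rel f z t \/ z = x /\ t = y.
Proof.
  unfold add; rewrite !rel_iff, in_cup, in_up; split; [|intuition congruence].
  intros [H | [H | H]]; auto; apply pr_inj in H; auto.
Qed.

Lemma DF_add (f s t : (nat -> V) -> V) : DF f -> DF s -> DF t ->
  DF (fun e => add (f e) (s e) (t e)).
Proof. intros; unfold add; dp. Qed.

Lemma rel_emp (x y : V) : ~ rel emp x y.
Proof. rewrite rel_iff, in_emp; auto. Qed.

Lemma emp_function : is_function (@emp M hM).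
Proof.
  split; [intros p Hp; apply in_emp in Hp; tauto | intros x y z H; destruct (rel_emp H)].
Qed.

Lemma add_function f x y : is_function f -> ~ in_dom f x -> is_function (add f x y).
Proof.
  intros [Hr Hf] Hx; split.
  - intros p Hp; unfold add in Hp; rewrite in_cup, in_up in Hp.
    destruct Hp as [Hp | Hp]; [auto|]; exists x, y; apply opair_iff; tauto.
  - intros z a b; rewrite !rel_add; intros [Ha | [-> ->]] [Hb | [E ->]]; eauto.
    + subst; destruct Hx; exists a; auto.
    + destruct Hx; exists b; auto.
Qed.

Lemma add_injective f x y : is_injective f -> ~ in_ran f y -> is_injective (add f x y).
Proof.
  intros Hi Hy z z' t; rewrite !rel_add; intros [Ha | [-> ->]] [Hb | [E E']]; subst; eauto.
  - destruct Hy; exists z; auto.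
  - destruct Hy; exists z'; auto.
Qed.

Lemma emp_finite : is_finite (@emp M hM).
Proof.
  exists emp, emp; split; [apply nat_zero | split; [apply emp_function |]]; split; [|split].
  - intros x x' y H; destruct (rel_emp H).
  - intros i; rewrite in_emp; split; [intros [y H]; destruct (rel_emp H) | tauto].
  - intros i; rewrite in_emp; split; [intros [y H]; destruct (rel_emp H) | tauto].
Qed.

Lemma cup_finite x y : is_finite x -> is_finite (cup x (up y y)).
Proof.
  intros H; destruct (classic (y ∈ x)) as [K | K].
  { replace (cup x (up y y)) with x; [exact H|].
    apply ext; intros z; rewrite in_cup, in_up; intuition congruence. }
  destruct H as [n [f [Hn [Hf [Hi [Hd Hr]]]]]].
  exists (suc n), (add f n y); split; [apply nat_succ; auto|]; split; [|split; [|split]].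
  - apply add_function; auto; rewrite Hd; apply no_self.
  - apply add_injective; auto; rewrite Hr; exact K.
  - intros i; rewrite in_suc, <- Hd; split.
    + intros [z Hz]; apply rel_add in Hz; destruct Hz as [Hz | [-> _]]; [left; exists z|]; auto.
    + intros [[z Hz] | ->]; [exists z | exists y]; apply rel_add; auto.
  - intros i; rewrite in_cup, in_up, <- Hr; split.
    + intros [z Hz]; apply rel_add in Hz; destruct Hz as [Hz | [_ ->]]; [left; exists z|]; auto.
    + intros [[z Hz] | H]; [exists z; apply rel_add; auto|].
      exists n; apply rel_add; tauto.
Qed.

Lemma finite_induction (P : V -> Prop) : D1 P -> P emp ->
  (forall x y, P x -> P (cup x (up y y))) -> forall x, is_finite x -> P x.
Proof.
  intros HP H0 HS x [n [f [Hn K]]].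
  revert n Hn x f K.
  (* Injectivity of the enumeration is dropped. Restricting it to [n] enumerates a subset of [x],
     and the value at [n], possibly a repetition, completes it to [x]. *)
  enough (Q : forall n, is_nat n -> forall x f, is_function f ->
    (forall i, in_dom f i <-> i ∈ n) -> (forall y, in_ran f y <-> y ∈ x) -> P x).
  { intros n Hn x f [Hf [_ [Hd Hr]]]; exact (Q n Hn x f Hf Hd Hr). }
  by_ind2 (@nat_induction M hM).
  - intros x f Hf Hd Hr; replace x with (@emp M hM); [exact H0|].
    apply ext; intros z; rewrite in_emp; split; [tauto|].
    intros Hz; apply Hr in Hz; destruct Hz as [i Hi].
    apply (in_emp i), Hd; exists z; auto.
  - intros n _ IH x f Hf Hd Hr.
    set (f' := sep f (fun p => exists i y, i ∈ n /\ p = pr i y)).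
    assert (Hf' : forall i y, rel f' i y <-> i ∈ n /\ rel f i y).
    { intros i y; rewrite !rel_iff; unfold f'; rewrite in_sep by d1; split.
      - intros [Hp [i' [y' [Hi E]]]]; apply pr_inj in E; destruct E; subst; auto.
      - intros [Hi Hp]; eauto. }
    set (x' := sep x (in_ran f')).
    assert (Hx' : forall y, y ∈ x' <-> y ∈ x /\ in_ran f' y).
    { intros y; unfold x'; rewrite in_sep by d1; reflexivity. }
    destruct (proj2 (Hd n)) as [y Hy]; [apply in_suc; auto|].
    replace x with (cup x' (up y y)).
    + apply HS, (IH x' f').
      * split; [|intros a b c; rewrite !Hf'; intros [_ A] [_ B]; exact (proj2 Hf _ _ _ A B)].
        intros p Hp; apply in_sep in Hp; [|d1]; apply (proj1 Hf), Hp.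
      * intros i; unfold in_dom; split; [intros [z Hz]; apply Hf' in Hz; tauto|].
        intros Hi; destruct (proj2 (Hd i)) as [z Hz]; [apply in_suc; auto|].
        exists z; apply Hf'; auto.
      * intros z; rewrite Hx'; split; [|tauto].
        intros Hz; split; [|exact Hz]; destruct Hz as [i Hi]; apply Hf' in Hi.
        apply Hr; exists i; tauto.
    + apply ext; intros z; rewrite in_cup, in_up, Hx'; split.
      * intros [Hz | [-> | ->]]; [tauto| |]; apply Hr; exists n; auto.
      * intros Hz; assert (Hz' := Hz); apply Hr in Hz'; destruct Hz' as [i Hi].
        assert (Di : i ∈ suc n) by (apply Hd; exists z; auto).
        apply in_suc in Di; destruct Di as [Di | ->].
        -- left; split; [exact Hz|]; exists i; apply Hf'; auto.
        -- right; left; exact (proj2 Hf _ _ _ Hi Hy).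
Qed.

Lemma subset_finite (x : V) : is_finite x -> forall y, subset y x -> is_finite y.
Proof.
  revert x; by_ind2 (@finite_induction).
  - apply D1_of; repeat (apply DP_is_finite || dp_step).
  - intros y Hy; replace y with (@emp M hM); [apply emp_finite|].
    apply ext; intros z; rewrite in_emp; split; [tauto|].
    intros Hz; apply Hy in Hz; apply in_emp in Hz; exact Hz.
  - intros x t IH y Hy; set (y' := sep y (fun z => z <> t)).
    assert (Hy' : forall z, z ∈ y' <-> z ∈ y /\ z <> t) by (intros; unfold y'; rewrite in_sep by d1; reflexivity).
    assert (F : is_finite y').
    { apply IH; intros z Hz; apply Hy' in Hz; destruct Hz as [Hz N]; apply Hy in Hz.
      rewrite in_cup, in_up in Hz; tauto. }
    destruct (classic (t ∈ y)) as [T | T].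
    + replace y with (cup y' (up t t)); [apply cup_finite, F|].
      apply ext; intros z; rewrite in_cup, in_up, Hy'; destruct (classic (z = t)); subst; tauto.
    + replace y with y'; [exact F|].
      apply ext; intros z; rewrite Hy'; split; [tauto|]; split; [auto|congruence].
Qed.

Lemma fresh_nat (f : V) : is_finite f -> exists n, is_nat n /\ ~ in_dom f n.
Proof.
  (* A strict upper bound for the numbers in the domain can be raised when a pair is added, and it
     lies outside the domain because no set is a member of itself. *)
  intros H; enough (K : exists n, is_nat n /\ forall m y, is_nat m -> rel f m y -> m ∈ n).
  { destruct K as [n [Hn K]]; exists n; split; [exact Hn|]; intros [y Hy].
    exact (no_self n (K n y Hn Hy)). }
  revert f H; by_ind2 (@finite_induction).
  - exists emp; split; [apply nat_zero|]; intros m y _ H; destruct (rel_emp H).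
  - intros f p [n [Hn K]].
    destruct (classic (exists m y, is_nat m /\ p = pr m y)) as [[m [y [Hm ->]]] | N].
    + assert (L : exists k, is_nat k /\ subset n k /\ m ∈ k).
      { destruct (nat_total Hn Hm) as [L | [L | L]].
        - exists n; firstorder.
        - subst m; exists (suc n); split; [apply nat_succ, Hn|].
          split; [intros z Hz|]; apply in_suc; auto.
        - exists (suc m); split; [apply nat_succ, Hm|].
          split; [intros z Hz|]; apply in_suc; auto; left; exact (nat_trans Hm _ L _ Hz). }
      destruct L as [k [Hk [Lk Mk]]]; exists k; split; [exact Hk|].
      intros m' y' Hm' H; apply rel_add in H; destruct H as [H | [-> ->]]; [|exact Mk].
      apply Lk; eauto.
    + exists n; split; [exact Hn|]; intros m y Hm H.
      rewrite rel_iff, in_cup, in_up in H; destruct H as [H | H].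
      * apply (K m y Hm), rel_iff, H.
      * destruct N; exists m, y; intuition.
Qed.

(** The range itself is not a value, since no set is a member of itself. It is a set by replacement
    on [uni (uni f)], which contains the components of all pairs in [f]. *)
Lemma fresh_set (f : V) : is_function f -> exists b, ~ in_ran f b.
Proof.
  intros [_ Hf]; destruct (@small_img M hM (fun x y => rel f x y) (uni (uni f)))
    as [r Hr]; [d2|exact Hf|].
  exists r; intros [x Hx]; apply (no_self r), Hr; exists x; split; [|exact Hx].
  apply rel_iff in Hx; destruct (pr_left x r) as [z [Hz Kz]].
  apply in_uni; exists z; split; [|exact Kz]; apply in_uni; eauto.
Qed.

Lemma coll_emp : is_coll (@emp M hM).
Proof.
  split; [apply emp_function|]; split; [intros x x' y H; destruct (rel_emp H)|].
  split; [apply emp_finite | intros n [y H]; destruct (rel_emp H)].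
Qed.

Lemma coll_add f n b : is_coll f -> is_nat n -> ~ in_dom f n -> ~ in_ran f b ->
  is_coll (add f n b).
Proof.
  intros [H1 [H2 [H3 H4]]] Hn Hd Hb; repeat split.
  - apply add_function; auto.
  - apply add_function; auto.
  - apply add_injective; auto.
  - apply cup_finite, H3.
  - intros m [y Hy]; apply rel_add in Hy; destruct Hy as [Hy | [-> _]]; [|exact Hn].
    apply H4; exists y; exact Hy.
Qed.

Lemma subset_add f x y : subset f (add f x y).
Proof. intros p Hp; apply in_cup; auto. Qed.

End Finite.

Ltac dp_finite ::= first [simple apply DP_is_nat | simple apply DF_suc
  | simple apply DP_is_function | simple apply DP_is_injective
  | simple apply DP_in_dom | simple apply DP_in_ran | simple apply DP_is_finite
  | simple apply DP_is_coll | simple apply DF_add].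

(** * The conditions of the forcing, their order, and names *)

Section Conditions.
Context {M : structure} {hM : GBC M}.
Notation V := (vset M).

Fixpoint tg (k : nat) : V := match k with 0 => emp | S k => up (tg k) (tg k) end.

Lemma tag_iff k : forall t : V, is_tag k t <-> t = tg k.
Proof.
  induction k; intros t; simpl; [apply empty_iff|].
  split; [intros [s [H K]]; rewrite IHk, upair_iff in *; congruence|].
  intros ->; exists (tg k); rewrite IHk, upair_iff; auto.
Qed.

Lemma tg_inj j : forall k, tg j = tg k -> j = k.
Proof.
  induction j; intros [|k] H; simpl in H; auto.
  - destruct (proj1 (in_emp (tg k))); rewrite H; apply in_up; auto.
  - destruct (proj1 (in_emp (tg j))); rewrite <- H; apply in_up; auto.
  - f_equal; apply IHj; assert (K : tg j ∈ up (tg k) (tg k)) by (rewrite <- H; apply in_up; auto).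
    apply in_up in K; tauto.
Qed.

Lemma tagged_iff k (u x : V) : tagged k u x <-> u = pr (tg k) x.
Proof.
  unfold tagged; split; [intros [t [H K]]; rewrite tag_iff, opair_iff in *; congruence|].
  intros ->; exists (tg k); rewrite tag_iff, opair_iff; auto.
Qed.

Lemma tagged2_iff k (u x y : V) : tagged2 k u x y <-> u = pr (tg k) (pr x y).
Proof.
  unfold tagged2; split; [intros [t [H K]]; rewrite tagged_iff, opair_iff in *; congruence|].
  intros ->; exists (pr x y); rewrite tagged_iff, opair_iff; auto.
Qed.

Lemma tagged_inj j k x y : pr (tg j) x = pr (tg k) y -> j = k /\ x = y.
Proof. intros H; apply pr_inj in H; destruct H as [H ->]; apply tg_inj in H; auto. Qed.

Lemma DP_tagged k (s t : (nat -> V) -> V) : DF s -> DF t -> DP (fun e => tagged k (s e) (t e)).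
Proof.
  intros Hs Ht; apply DP_iff with (fun e => s e = pr (tg k) (t e)); [|dp].
  intros e; apply tagged_iff.
Qed.

Lemma DP_tagged2 k (s t u : (nat -> V) -> V) : DF s -> DF t -> DF u ->
  DP (fun e => tagged2 k (s e) (t e) (u e)).
Proof.
  intros Hs Ht Hu; apply DP_iff with (fun e => s e = pr (tg k) (pr (t e) (u e))); [|dp].
  intros e; apply tagged2_iff.
Qed.

Definition cnd (f : V) : V := pr (tg 0) f.
Definition top : V := cnd emp.

(** The empty condition lies above all of the forcing, including those
    [e_{n,m}] and [a_n] that have no condition of [Coll] below them; below a
    nonempty [f] there are only conditions of [Coll]. *)
Definition good (f : V) : Prop := is_coll f /\ f <> emp.

Context (A : vclass M).
Definition below (h r : V) : Prop := FA_le A (cnd h) r.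

Lemma coll_cond f : is_coll f -> cond_coll (cnd f) f.
Proof. intros H; split; [exact H | apply tagged_iff; reflexivity]. Qed.

Lemma cond_coll_cnd p f : cond_coll p f -> p = cnd f.
Proof. intros [_ H]; apply tagged_iff in H; exact H. Qed.

Lemma below_top h : good h -> below h top.
Proof.
  intros [H _]; apply FA_le_top with emp.
  - left; exists h; apply coll_cond, H.
  - apply coll_cond, coll_emp.
  - apply empty_iff; reflexivity.
Qed.

Lemma le_good p f : good f -> FA_le A p (cnd f) <-> exists g, good g /\ subset f g /\ p = cnd g.
Proof.
  intros [Hf Nf]; split.
  - assert (C : forall g, cond_coll (cnd f) g -> g = f).
    { intros g Hg; apply cond_coll_cnd, tagged_inj in Hg; symmetry; tauto. }
    intros [g g' Hg Hg' H | g n m x y Hg [_ [_ H]] _ _ _ | g n x Hg [_ H] _ _ | g Hp Hg H | Hp ->].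
    + rewrite (C g' Hg') in H; exists g; split; [split; [apply Hg|]|split; [exact H|]].
      * intros ->; apply Nf, ext; intros z; split; [apply H|].
        intros Hz; apply in_emp in Hz; tauto.
      * apply cond_coll_cnd, Hg.
    + apply tagged2_iff, tagged_inj in H; destruct H; discriminate.
    + apply tagged_iff, tagged_inj in H; destruct H; discriminate.
    + rewrite (C g Hg), empty_iff in H; destruct (Nf H).
    + exists f; split; [split; assumption | split; [intros z Hz; exact Hz | reflexivity]].
  - intros [g [[Hg _] [H ->]]]; apply FA_le_coll with g f; auto; apply coll_cond; assumption.
Qed.

Definition ec (n m : V) : V := pr (tg 1) (pr n m).
Definition ac (n : V) : V := pr (tg 2) n.

Lemma ec_cond n m : is_nat n -> is_nat m -> cond_e (ec n m) n m.
Proof. intros Hn Hm; split; [|split]; auto; apply tagged2_iff; reflexivity. Qed.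

Lemma ac_cond n : is_nat n -> cond_a (ac n) n.
Proof. intros Hn; split; auto; apply tagged_iff; reflexivity. Qed.

Lemma cnd_inj f g : cnd f = cnd g -> f = g.
Proof. intros H; apply tagged_inj in H; apply H. Qed.

Lemma below_ec h n m : good h -> is_nat n -> is_nat m ->
  (below h (ec n m) <-> exists x y, rel h n x /\ rel h m y /\ x ∈ y).
Proof.
  intros [Hh Nh] Hn Hm; split.
  - intros [f g _ [_ H] _ | f n' m' x y Hf [_ [_ H]] Hx Hy K | f n' x _ [_ H] _ _ | g _ [_ H] _ | _ H].
    + apply tagged_iff, tagged_inj in H; destruct H; discriminate.
    + apply tagged2_iff, tagged_inj in H; destruct H as [_ H]; apply pr_inj in H.
      destruct H; subst; apply cond_coll_cnd, cnd_inj in Hf; subst; eauto.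
    + apply tagged_iff, tagged_inj in H; destruct H; discriminate.
    + apply tagged_iff, tagged_inj in H; destruct H; discriminate.
    + apply tagged_inj in H; destruct H; discriminate.
  - intros [x [y [Hx [Hy K]]]]; apply FA_le_e with h n m x y; auto; [apply coll_cond, Hh | apply ec_cond; auto].
Qed.

Lemma below_ac h n : good h -> is_nat n ->
  (below h (ac n) <-> exists x, rel h n x /\ x ∈c A).
Proof.
  intros [Hh Nh] Hn; split.
  - intros [f g _ [_ H] _ | f n' m' x y Hf [_ [_ H]] Hx Hy K | f n' x Hf [_ H] Hx K | g _ [_ H] _ | _ H].
    + apply tagged_iff, tagged_inj in H; destruct H; discriminate.
    + apply tagged2_iff, tagged_inj in H; destruct H; discriminate.
    + apply tagged_iff, tagged_inj in H; destruct H as [_ H].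
      apply cond_coll_cnd, cnd_inj in Hf; subst; eauto.
    + apply tagged_iff, tagged_inj in H; destruct H; discriminate.
    + apply tagged_inj in H; destruct H; discriminate.
  - intros [x [Hx K]]; apply FA_le_a with h n x; auto; [apply coll_cond, Hh | apply ac_cond; auto].
Qed.

Lemma rel_subset (f g x y : V) : subset f g -> rel f x y -> rel g x y.
Proof. rewrite !rel_iff; auto. Qed.

Lemma below_mono h h' r : FA_cond r -> good h -> good h' -> subset h h' ->
  below h r -> below h' r.
Proof.
  intros Hr Hh Hh' K H.
  destruct Hr as [[f [Hf Hr]] | [[n [m [Hn [Hm Hr]]]] | [n [Hn Hr]]]].
  - apply tagged_iff in Hr; fold (cnd f) in Hr; subst r.
    destruct (classic (f = emp)) as [-> | Nf]; [apply below_top, Hh'|].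
    assert (Gf : good f) by (split; auto).
    apply (le_good _ Gf) in H; destruct H as [g [_ [L E]]]; apply cnd_inj in E; subst g.
    apply le_good; [exact Gf|]; exists h'; split; [exact Hh'|split; [|reflexivity]].
    intros z Hz; auto.
  - apply tagged2_iff in Hr; fold (ec n m) in Hr; subst r; rewrite below_ec in *; auto.
    destruct H as [x [y [Hx [Hy L]]]]; exists x, y; eauto using rel_subset.
  - apply tagged_iff in Hr; fold (ac n) in Hr; subst r; rewrite below_ac in *; auto.
    destruct H as [x [Hx L]]; exists x; eauto using rel_subset.
Qed.

Lemma DP_good (t : (nat -> V) -> V) : DF t -> DP (fun e => good (t e)).
Proof. apply DP_sub1; unfold good; dp. Qed.

Ltac dp_local ::= first [simple apply DP_good | simple apply DP_tagged | simple apply DP_tagged2].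

Lemma DP_FA_cond (t : (nat -> V) -> V) : DF t -> DP (fun e => FA_cond (t e)).
Proof. apply DP_sub1; unfold FA_cond, cond_coll, cond_e, cond_a; dp. Qed.

Lemma DF_cnd (t : (nat -> V) -> V) : DF t -> DF (fun e => cnd (t e)).
Proof. intros; unfold cnd; dp. Qed.

Lemma DP_below (s t : (nat -> V) -> V) : DF s -> DF t -> DP (fun e => below (s e) (t e)).
Proof.
  apply (@DP_sub2 M (fun h r => FA_le A (cnd h) r)).
  apply (@DP_sub2 M (fun p q => FA_le A p q)); [|apply DF_cnd; dp|dp].
  (* An inductive predicate is not a formula of the structure, so the constructors of [FA_le] are
     spelled out as a disjunction. *)
  apply DP_iff with (fun e =>
    (exists f g, cond_coll (e 1) f /\ cond_coll (e 0) g /\ subset g f) \/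
    (exists f n m x y, cond_coll (e 1) f /\ cond_e (e 0) n m /\ rel f n x /\ rel f m y /\ x ∈ y) \/
    (exists f n x, cond_coll (e 1) f /\ cond_a (e 0) n /\ rel f n x /\ x ∈c A) \/
    (exists g, FA_cond (e 1) /\ cond_coll (e 0) g /\ is_empty g) \/
    (FA_cond (e 1) /\ e 1 = e 0)).
  - intros e; split.
    + intros [f g | f n m x y | f n x | g |].
      * left; eauto.
      * right; left; exists f, n, m, x, y; auto.
      * right; right; left; exists f, n, x; auto.
      * right; right; right; left; exists g; auto.
      * right; right; right; right; auto.
    + intros [[f [g H]] | [[f [n [m [x [y H]]]]] | [[f [n [x H]]] | [[g H] | H]]]].
      * eapply FA_le_coll; apply H.
      * eapply FA_le_e; apply H.
      * eapply FA_le_a; apply H.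
      * eapply FA_le_top; apply H.
      * apply FA_le_refl; apply H.
  - unfold FA_cond, cond_e, cond_a, cond_coll; dp.
Qed.

Lemma DP_name (t : (nat -> V) -> V) : DF t -> DP (fun e => is_name FA_cond (t e)).
Proof. apply DP_sub1; unfold is_name; repeat (apply DP_FA_cond || dp_step). Qed.

Notation name := (is_name (@FA_cond M)).

Lemma name_elim t u : name t -> u ∈ t -> exists s r, u = pr s r /\ name s /\ FA_cond r.
Proof.
  intros [D [H K]] Hu; destruct (K t H u Hu) as [s [r [E [Hs Hr]]]].
  apply opair_iff in E; exists s, r; split; [|split]; auto; exists D; auto.
Qed.

Lemma name_rel t s r : name t -> rel t s r -> name s /\ FA_cond r.
Proof.
  intros H K; apply rel_iff in K; destruct (@name_elim t (pr s r) H K) as [s' [r' [E [Hs Hr]]]].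
  apply pr_inj in E; destruct E; subst; auto.
Qed.

(** A single closed set must witness that [t] is a name, while the hypothesis gives one for each
    element. The closed sets for one element are stable under intersection, as a pair determines its
    components, so [collect_min] gathers them; their union together with [t] is closed. *)
Lemma name_intro t : (forall u, u ∈ t -> exists s r, u = pr s r /\ name s /\ FA_cond r) -> name t.
Proof.
  intros H.
  set (C := fun D => forall tau, tau ∈ D -> forall u, u ∈ tau ->
      exists rho r : V, is_opair u rho r /\ rho ∈ D /\ FA_cond r).
  set (I := fun u D => exists s r, u = pr s r /\ s ∈ D /\ FA_cond r /\ C D).
  destruct (@collect_min M hM I t) as [W [HW HW']].
  - unfold I, C; apply D2_of; repeat (apply DP_FA_cond || dp_step).
  - intros u Hu; destruct (H u Hu) as [s [r [E [[D [Hs HD]] Hr]]]]; exists D, s, r; auto.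
  - intros u D _ [s [r [E [Hs [Hr HD]]]]] D0 H0; exists s, r.
    assert (L : I u D) by (exists s, r; auto).
    split; [|split; [|split]]; auto.
    + apply H0; intros D' [s' [r' [E' [Hs' _]]]]; rewrite E in E'; apply pr_inj in E'.
      destruct E'; subst; auto.
    + intros tau Ht u' Hu'; assert (Ht' := proj1 (H0 tau) Ht D L).
      destruct (HD tau Ht' u' Hu') as [s2 [r2 [E2 [Hs2 Hr2]]]]; exists s2, r2.
      split; [|split]; auto; apply H0; intros D' HD'.
      assert (Ht2 := proj1 (H0 tau) Ht D' HD'); destruct HD' as [_ [_ [_ [_ [_ HD']]]]].
      destruct (HD' tau Ht2 u' Hu') as [s3 [r3 [E3 [Hs3 _]]]].
      destruct (opair_inj E2 E3); subst; auto.
  - exists (cup (uni W) (up t t)).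
    assert (Q : forall u D, I u D -> D ∈ W -> exists s r, is_opair u s r /\
      s ∈ cup (uni W) (up t t) /\ FA_cond r).
    { intros u D [s [r [E [Hs [Hr HD]]]]] KD; exists s, r; rewrite opair_iff.
      split; [|split]; auto; apply in_cup; left; apply in_uni; eauto. }
    split; [apply in_cup; right; apply in_up; auto|].
    intros tau Ht u Hu; rewrite in_cup, in_uni, in_up in Ht.
    destruct Ht as [[D [KD Ht]] | Ht].
    + destruct (HW' D KD) as [_ [_ [s [r [_ [_ [_ HD]]]]]]].
      destruct (HD tau Ht u Hu) as [s2 [r2 [E2 [Hs2 Hr2]]]]; exists s2, r2.
      split; [|split]; auto; apply in_cup; left; apply in_uni; eauto.
    + assert (tau = t) as -> by tauto; destruct (HW u Hu) as [D [KD HD]]; eauto.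
Qed.

End Conditions.

Ltac dp_forcing ::= first [simple apply DP_good | simple apply DP_tagged
  | simple apply DP_tagged2 | simple apply DP_FA_cond | simple apply DF_cnd
  | simple apply DP_below | simple apply DP_name].

(** * Forcing equalities of names *)

Section Forcing.
Context {M : structure} {hM : GBC M}.
Notation V := (vset M).
Context (A : vclass M) (Fin Fsub Feq : vclass M).
Context (HF : is_atomic_forcing FA_cond (FA_le A) Fin Fsub Feq).
Notation name := (is_name (@FA_cond M)).
Notation below := (below A).

Definition FE (f s t : V) : Prop := crel3 Feq (cnd f) s t.
Definition FI (f s t : V) : Prop := crel3 Fin (cnd f) s t.
Definition FS (f s t : V) : Prop := crel3 Fsub (cnd f) s t.

Lemma DP_FE (f s t : (nat -> V) -> V) : DF f -> DF s -> DF t ->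
  DP (fun e => FE (f e) (s e) (t e)).
Proof. intros; unfold FE; dp. Qed.

(** Density within the nonempty finite injections, where conditions are identified with injections
    and stronger means larger. *)
Definition dense (f : V) (S : V -> Prop) : Prop :=
  forall g, good g -> subset f g -> exists h, good h /\ subset g h /\ S h.

Lemma subset_refl (f : V) : subset f f.
Proof. intros z Hz; exact Hz. Qed.

Lemma subset_trans (f g h : V) : subset f g -> subset g h -> subset f h.
Proof. intros H K z Hz; auto. Qed.

Hint Resolve subset_refl : core.

Lemma dense_mono f g S : subset f g -> dense f S -> dense g S.
Proof. intros H K h Hh L; apply K; eauto using subset_trans. Qed.

Lemma dense_imp f (S S' : V -> Prop) :
  (forall g, good g -> subset f g -> S g -> S' g) -> dense f S -> dense f S'.
Proof.
  intros H K g Hg L; destruct (K g Hg L) as [h [Hh [N P]]]; exists h.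
  eauto using subset_trans.
Qed.

Lemma dense_dense f S : dense f (fun g => dense g S) -> dense f S.
Proof.
  intros H g Hg L; destruct (H g Hg L) as [h [Hh [N P]]].
  destruct (P h Hh) as [k [Hk [Q R]]]; eauto using subset_trans.
Qed.

Lemma dense_all f (S : V -> Prop) : (forall g, good g -> subset f g -> S g) -> dense f S.
Proof. intros H g Hg L; exists g; auto. Qed.

Lemma dense_ex f S : good f -> dense f S -> exists g, good g /\ subset f g /\ S g.
Proof. intros H K; apply K; auto. Qed.

Lemma good_cond f : good f -> FA_cond (cnd f).
Proof. intros [H _]; left; exists f; apply coll_cond, H. Qed.

(** Whatever lies below a nonempty injection is one as well, by [le_good], so the clause for
    membership can be read among the [good] injections. Arbitrary conditions survive only inside
    names, through [below]. *)
Lemma FI_iff f s t : good f -> name s -> name t ->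
  (FI f s t <-> dense f (fun g => exists u r, rel t u r /\ below g r /\ FE g s u)).
Proof.
  intros Hf Hs Ht; unfold FI; rewrite (proj1 (HF (good_cond Hf) Hs Ht)); split.
  - intros H g Hg L; destruct (H (cnd g)) as [q [Hq [u [r [K1 [K2 K3]]]]]].
    { apply le_good; [exact Hf|]; exists g; auto. }
    apply le_good in Hq; [|exact Hg]; destruct Hq as [h [Hh [N ->]]].
    exists h; split; [|split]; auto; exists u, r; auto.
  - intros H p' Hp; apply le_good in Hp; [|exact Hf]; destruct Hp as [g [Hg [L ->]]].
    destruct (H g Hg L) as [h [Hh [N [u [r K]]]]]; exists (cnd h); split; [|eauto].
    apply le_good; [exact Hg|]; exists h; auto.
Qed.

Lemma FE_iff f s t : good f -> name s -> name t -> (FE f s t <-> FS f s t /\ FS f t s).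
Proof. intros Hf Hs Ht; exact (proj1 (proj2 (HF (good_cond Hf) Hs Ht))). Qed.

Lemma FI_dense f s t : good f -> name s -> name t -> dense f (fun g => FI g s t) -> FI f s t.
Proof.
  intros Hf Hs Ht H; apply FI_iff; auto; apply dense_dense; revert H; apply dense_imp.
  intros g Hg L; apply FI_iff; auto.
Qed.

Lemma FI_mono f g s t : good f -> good g -> name s -> name t -> subset f g ->
  FI f s t -> FI g s t.
Proof.
  intros Hf Hg Hs Ht L H; rewrite FI_iff in *; auto; exact (dense_mono L H).
Qed.

(** The given clause provides membership only at some condition below each [q']. Forced membership
    is closed under density, so it holds at every [g] concerned. *)
Lemma FS_iff f s t : good f -> name s -> name t ->
  (FS f s t <-> forall u r, rel s u r -> forall g, good g -> subset f g -> below g r -> FI g u t).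
Proof.
  intros Hf Hs Ht; unfold FS; rewrite (proj2 (proj2 (HF (good_cond Hf) Hs Ht))); split.
  - intros H u r Hu g Hg L B; destruct (name_rel Hs Hu) as [Nu Cr].
    apply FI_dense; auto; intros g' Hg' L'.
    destruct (H u r Hu (cnd g')) as [q [Hq K]].
    { apply le_good; [exact Hf|]; exists g'; eauto using subset_trans. }
    { exact (below_mono Cr Hg Hg' L' B). }
    apply le_good in Hq; [|exact Hg']; destruct Hq as [h [Hh [N ->]]]; eauto.
  - intros H u r Hu q Hq B; apply le_good in Hq; [|exact Hf].
    destruct Hq as [g [Hg [L ->]]]; exists (cnd g); split; [|apply (H u r); auto].
    apply le_good; [exact Hg|]; exists g; auto.
Qed.

Lemma FS_mono f g s t : good f -> good g -> name s -> name t -> subset f g ->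
  FS f s t -> FS g s t.
Proof.
  intros Hf Hg Hs Ht L H; rewrite FS_iff in *; auto.
  intros u r Hu h Hh N; eapply H; eauto using subset_trans.
Qed.

Lemma FS_dense f s t : good f -> name s -> name t -> dense f (fun g => FS g s t) -> FS f s t.
Proof.
  intros Hf Hs Ht H; apply FS_iff; auto; intros u r Hu g Hg L B.
  destruct (name_rel Hs Hu) as [Nu Cr].
  apply FI_dense; auto; intros g' Hg' L'.
  destruct (H g' Hg') as [h [Hh [N K]]]; [eauto using subset_trans|].
  exists h; split; [|split]; auto; rewrite FS_iff in K; auto; apply (K u r); auto.
  apply (below_mono Cr Hg Hh); eauto using subset_trans.
Qed.

Lemma FE_mono f g s t : good f -> good g -> name s -> name t -> subset f g ->
  FE f s t -> FE g s t.
Proof.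
  intros Hf Hg Hs Ht L; rewrite !FE_iff; auto; intros [H K].
  exact (conj (FS_mono Hf Hg Hs Ht L H) (FS_mono Hf Hg Ht Hs L K)).
Qed.

Lemma FE_dense f s t : good f -> name s -> name t -> dense f (fun g => FE g s t) -> FE f s t.
Proof.
  intros Hf Hs Ht H; apply FE_iff; auto; split; apply FS_dense; auto; revert H;
    apply dense_imp; intros g Hg _ K; apply FE_iff in K; tauto.
Qed.

Lemma FE_sym f s t : good f -> name s -> name t -> FE f s t -> FE f t s.
Proof. intros Hf Hs Ht; rewrite !FE_iff; tauto. Qed.

Ltac dp_local ::= simple apply DP_FE.

Lemma name_induction (P : V -> Prop) : D1 P ->
  (forall s, name s -> (forall u r, rel s u r -> name u -> P u) -> P s) ->
  forall s, name s -> P s.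
Proof.
  intros HP H; by_ind (@deep_induction M hM); intros s IH Hs; apply H; [exact Hs|].
  intros u r Hu; apply rel_iff in Hu; destruct (pr_left u r) as [z [Hz Kz]].
  intros Nu; exact (proj1 (proj2 (IH _ Hu _ Hz) u Kz) Nu).
Qed.

Lemma FE_refl s : name s -> forall f, good f -> FE f s s.
Proof.
  revert s; match goal with |- forall k, _ -> @?Q k => refine (@name_induction Q _ _) end; [d1|].
  intros s Hs IH f Hf; apply FE_iff; auto.
  enough (FS f s s) by auto.
  apply FS_iff; auto; intros u r Hu g Hg L B; destruct (name_rel Hs Hu) as [Nu Cr].
  apply FI_iff; auto; apply dense_all; intros h Hh N; exists u, r.
  split; [exact Hu | split; [exact (below_mono Cr Hg Hh N B) | eauto]].
Qed.

Lemma FE_trans s : name s -> forall t u f, name t -> name u -> good f ->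
  FE f s t -> FE f t u -> FE f s u.
Proof.
  revert s; match goal with |- forall k, _ -> @?Q k => refine (@name_induction Q _ _) end; [d1|].
  intros s Hs IH t u f Ht Hu Hf; rewrite !FE_iff; auto.
  intros [Hst Hts] [Htu Hut]; rewrite FS_iff in Hst, Hts, Htu, Hut; auto; rewrite !FS_iff; auto.
  split; intros x r Hx g Hg L B.
  - assert (K := Hst x r Hx g Hg L B); destruct (name_rel Hs Hx) as [Nx Cr].
    apply FI_iff in K; auto; apply FI_iff; auto; apply dense_dense.
    revert K; apply dense_imp; intros h Hh N [y [r' [Hy [B' E]]]].
    assert (K := Htu y r' Hy h Hh (subset_trans L N) B').
    destruct (name_rel Ht Hy) as [Ny Cr'].
    apply FI_iff in K; auto; revert K; apply dense_imp.
    intros k Hk N' [z [r2 [Hz [B2 E2]]]]; exists z, r2; split; [|split]; auto.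
    destruct (name_rel Hu Hz) as [Nz Cz].
    apply (IH x r Hx Nx y z k); auto; exact (FE_mono Hh Hk Nx Ny N' E).
  - assert (K := Hut x r Hx g Hg L B); destruct (name_rel Hu Hx) as [Nx Cr].
    apply FI_iff in K; auto; apply FI_iff; auto; apply dense_dense.
    revert K; apply dense_imp; intros h Hh N [y [r' [Hy [B' E]]]].
    assert (K := Hts y r' Hy h Hh (subset_trans L N) B').
    destruct (name_rel Ht Hy) as [Ny Cr'].
    apply FI_iff in K; auto; revert K; apply dense_imp.
    intros k Hk N' [z [r2 [Hz [B2 E2]]]]; exists z, r2; split; [|split]; auto.
    destruct (name_rel Hs Hz) as [Nz Cz].
    (* The induction hypothesis is about members of [s], so the chain x = y = z is read backwards,
       starting at [z]. *)
    apply FE_sym; auto; apply (IH z r2 Hz Nz y x k); auto; apply FE_sym; auto.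
    exact (FE_mono Hh Hk Nx Ny N' E).
Qed.

Lemma FI_congr f s t t' : good f -> name s -> name t -> name t' ->
  FE f t t' -> FI f s t -> FI f s t'.
Proof.
  intros Hf Hs Ht Ht' E H; apply FE_iff in E; auto; destruct E as [E _].
  rewrite FS_iff in E; auto; apply FI_iff in H; auto; apply FI_iff; auto.
  apply dense_dense; revert H; apply dense_imp; intros g Hg L [u [r [Hu [B K]]]].
  assert (Q := E u r Hu g Hg L B); destruct (name_rel Ht Hu) as [Nu Cu].
  apply FI_iff in Q; auto; revert Q; apply dense_imp; intros h Hh N [v [r' [Hv [B' E']]]].
  exists v, r'; split; [|split]; auto; destruct (name_rel Ht' Hv) as [Nv _].
  apply (FE_trans Hs Nu Nv Hh); [|exact E']; exact (FE_mono Hg Hh Hs Nu N K).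
Qed.

Lemma FI_congl f s s' t : good f -> name s -> name s' -> name t ->
  FE f s s' -> FI f s t -> FI f s' t.
Proof.
  intros Hf Hs Hs' Ht E H; rewrite FI_iff in *; auto; revert H; apply dense_imp.
  intros g Hg L [u [r [Hu [B K]]]]; exists u, r; split; [|split]; auto.
  destruct (name_rel Ht Hu) as [Nu _].
  apply (FE_trans Hs' Hs Nu Hg); [|exact K].
  apply FE_sym; auto; exact (FE_mono Hf Hg Hs Hs' L E).
Qed.

Definition nm (S : V) : V := img (fun s => pr s top) S.

Lemma DF_nm (t : (nat -> V) -> V) : DF t -> DF (fun e => nm (t e)).
Proof. intros; unfold nm; dp. Qed.

Lemma rel_nm S s r : rel (nm S) s r <-> s ∈ S /\ r = top.
Proof.
  rewrite rel_iff; unfold nm; rewrite in_img by d2; split.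
  - intros [x [Hx E]]; apply pr_inj in E; destruct E; subst; auto.
  - intros [Hs ->]; eauto.
Qed.

Lemma top_cond : FA_cond (@top M hM).
Proof. left; exists emp; apply coll_cond, coll_emp. Qed.

Definition names (S : V) : Prop := forall s, s ∈ S -> name s.

Lemma name_nm S : names S -> name (nm S).
Proof.
  intros H; apply name_intro; intros u Hu; unfold nm in Hu; rewrite in_img in Hu by d2.
  destruct Hu as [x [Hx ->]]; exists x, top; split; [|split]; auto; apply top_cond.
Qed.

Lemma FI_nm f s S : good f -> name s -> names S ->
  (FI f s (nm S) <-> dense f (fun g => exists u, u ∈ S /\ FE g s u)).
Proof.
  intros Hf Hs HS; rewrite FI_iff; auto using name_nm.
  split; apply dense_imp; intros g Hg _.
  - intros [u [r [Hu [_ E]]]]; apply rel_nm in Hu; exists u; tauto.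
  - intros [u [Hu E]]; exists u, top; rewrite rel_nm; auto using below_top.
Qed.

Lemma FI_in f s S : good f -> names S -> s ∈ S -> FI f s (nm S).
Proof.
  intros Hf HS Hs; apply FI_nm; auto; apply dense_all; intros g Hg _; exists s.
  auto using FE_refl.
Qed.

Lemma FS_nm f S t : good f -> names S -> name t ->
  (FS f (nm S) t <-> forall s, s ∈ S -> FI f s t).
Proof.
  intros Hf HS Ht; rewrite FS_iff; auto using name_nm; split.
  - intros H s Hs; apply (H s top); auto using below_top; apply rel_nm; auto.
  - intros H s r Hs g Hg L _; apply rel_nm in Hs; destruct Hs as [Hs _].
    apply (FI_mono Hf Hg); auto.
Qed.

Definition apart (s t : V) : Prop := forall f, good f -> ~ FE f s t.

Lemma apart_sym s t : name s -> name t -> apart s t -> apart t s.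
Proof. intros Hs Ht H f Hf K; apply (H f Hf), FE_sym; auto. Qed.

Lemma FI_nm_one f s S t : good f -> name s -> names S -> t ∈ S ->
  (forall u, u ∈ S -> u <> t -> apart s u) -> FI f s (nm S) -> FE f s t.
Proof.
  intros Hf Hs HS Ht H K; apply FI_nm in K; auto; apply FE_dense; auto.
  revert K; apply dense_imp; intros g Hg _ [u [Hu E]].
  destruct (classic (u = t)) as [-> | N]; [exact E|]; destruct (H u Hu N g Hg E).
Qed.

Lemma FI_nm_apart f s S : good f -> name s -> names S ->
  (forall u, u ∈ S -> apart s u) -> ~ FI f s (nm S).
Proof.
  intros Hf Hs HS H K; apply FI_nm in K; auto.
  destruct (dense_ex Hf K) as [g [Hg [_ [u [Hu E]]]]]; exact (H u Hu g Hg E).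
Qed.

(** A member [s i] of the left side must densely equal some member of the right side. Apartness
    excludes the members of [B] and all [t j] with [j] other than [i]; what remains is [t i], and
    forced equality is closed under density. *)
Lemma conj_gadget B (s t : V -> V) K f :
  D2 (fun i y => y = s i) -> D2 (fun i y => y = t i) -> names B ->
  (forall i, i ∈ K -> name (s i) /\ name (t i)) ->
  (forall i u, i ∈ K -> u ∈ B -> apart (s i) u /\ apart (t i) u) ->
  (forall i j, i ∈ K -> j ∈ K -> i <> j -> apart (s i) (t j)) ->
  good f ->
  (FE f (nm (cup B (img s K))) (nm (cup B (img t K))) <-> forall i, i ∈ K -> FE f (s i) (t i)).
Proof.
  intros Ds Dt HB HN HU Hap Hf.
  assert (Ns : names (cup B (img s K))).
  { intros x Hx; rewrite in_cup, in_img in Hx by assumption.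
    destruct Hx as [Hx | [i [Hi ->]]]; [auto | apply HN, Hi]. }
  assert (Nt : names (cup B (img t K))).
  { intros x Hx; rewrite in_cup, in_img in Hx by assumption.
    destruct Hx as [Hx | [i [Hi ->]]]; [auto | apply HN, Hi]. }
  rewrite FE_iff, !FS_nm; auto using name_nm; split.
  - intros [H _] i Hi; destruct (HN i Hi) as [Nsi Nti].
    apply FE_dense; auto.
    assert (L : FI f (s i) (nm (cup B (img t K)))).
    { apply H; rewrite in_cup, in_img by assumption; eauto. }
    apply FI_nm in L; auto; revert L; apply dense_imp; intros g Hg _ [u [Hu E]].
    rewrite in_cup, in_img in Hu by assumption; destruct Hu as [Hu | [j [Hj ->]]].
    + destruct (proj1 (HU i u Hi Hu) g Hg E).
    + destruct (classic (i = j)) as [<- | N]; [exact E|].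
      destruct (Hap i j Hi Hj N g Hg E).
  - intros H; split; intros x Hx; rewrite in_cup, in_img in Hx by assumption.
    + destruct Hx as [Hx | [i [Hi ->]]].
      * apply FI_in; auto; rewrite in_cup; auto.
      * destruct (HN i Hi) as [Nsi Nti].
        apply (@FI_congl f (t i)); auto using name_nm; [apply FE_sym; auto|].
        apply FI_in; auto; rewrite in_cup, in_img by assumption; eauto.
    + destruct Hx as [Hx | [i [Hi ->]]].
      * apply FI_in; auto; rewrite in_cup; auto.
      * destruct (HN i Hi) as [Nsi Nti].
        apply (@FI_congl f (s i)); auto using name_nm.
        apply FI_in; auto; rewrite in_cup, in_img by assumption; eauto.
Qed.

(** A name added to both sides of the equation is harmless, so the equation
    only says that [x] is one of the remaining elements. *)
Lemma member_gadget B x Y f : names B -> names Y -> name x ->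
  (forall u, u ∈ B -> apart x u) -> good f ->
  (FE f (nm (cup B (cup (sgl x) Y))) (nm (cup B Y)) <->
   dense f (fun g => exists y, y ∈ Y /\ FE g x y)).
Proof.
  intros HB HY Hx Hap Hf.
  assert (N1 : names (cup B (cup (sgl x) Y))).
  { intros z Hz; rewrite !in_cup, in_sgl in Hz; intuition; subst; auto. }
  assert (N2 : names (cup B Y)).
  { intros z Hz; rewrite in_cup in Hz; intuition. }
  rewrite FE_iff, !FS_nm; auto using name_nm; split.
  - intros [H _]; assert (L : FI f x (nm (cup B Y))).
    { apply H; rewrite !in_cup, in_sgl; auto. }
    apply FI_nm in L; auto; revert L; apply dense_imp; intros g Hg _ [u [Hu E]].
    apply in_cup in Hu; destruct Hu as [Hu | Hu]; [destruct (Hap u Hu g Hg E) | eauto].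
  - intros H; split; intros z Hz.
    + rewrite !in_cup, in_sgl in Hz.
      assert (Hz' : z = x \/ z ∈ cup B Y) by (rewrite in_cup; tauto).
      destruct Hz' as [-> | Hz']; [|apply FI_in; auto].
      apply FI_nm; auto; revert H; apply dense_imp; intros g Hg _ [y [Hy E]].
      exists y; rewrite in_cup; auto.
    + apply FI_in; auto; rewrite !in_cup, in_sgl in *; tauto.
Qed.

End Forcing.

Ltac dp_forcing ::= first [simple apply DP_good | simple apply DP_tagged
  | simple apply DP_tagged2 | simple apply DP_FA_cond | simple apply DF_cnd
  | simple apply DP_below | simple apply DP_name | simple apply DP_FE
  | simple apply DF_nm].

Notation dec := excluded_middle_informative.

(** * Formulas with a truth value as keys, and the names that express them *)

Section Codes.
Context {M : structure} {hM : GBC M}.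
Notation V := (vset M).

(** Application and projections are given by the elements of their values. As total [setof] terms
    they are definable, and they have the intended value whenever it exists and is unique. *)
Definition app (h i : V) : V := setof (fun w => exists y, pr i y ∈ h /\ w ∈ y).
Definition fst_pr (z : V) : V := setof (fun w => exists x y, z = pr x y /\ w ∈ x).
Definition snd_pr (z : V) : V := setof (fun w => exists x y, z = pr x y /\ w ∈ y).

Lemma setof_eq (P : V -> Prop) x : (forall w, P w <-> w ∈ x) -> setof P = x.
Proof.
  intros H; apply ext; intros w; rewrite in_setof; [apply H|].
  exists x; intros z; symmetry; apply H.
Qed.

Lemma fst_pr_eq x y : fst_pr (pr x y) = x.
Proof.
  apply setof_eq; intros w; split; [|eauto].
  intros [a [b [E H]]]; apply pr_inj in E; destruct E; subst; exact H.
Qed.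

Lemma snd_pr_eq x y : snd_pr (pr x y) = y.
Proof.
  apply setof_eq; intros w; split; [|eauto].
  intros [a [b [E H]]]; apply pr_inj in E; destruct E; subst; exact H.
Qed.

Lemma app_img (N : V -> V) K i : D2 (fun k y => y = N k) -> i ∈ K ->
  app (img (fun i => pr i (N i)) K) i = N i.
Proof.
  intros D Hi; apply setof_eq; intros w; split.
  - intros [y [H L]]; rewrite in_img in H by d2; destruct H as [j [_ E]].
    apply pr_inj in E; destruct E; subst; exact L.
  - intros H; exists (N i); rewrite in_img by d2; eauto.
Qed.

Lemma DF_app (s t : (nat -> V) -> V) : DF s -> DF t -> DF (fun e => app (s e) (t e)).
Proof. apply DF_sub2; unfold app; dp. Qed.

Lemma DF_fst_pr (t : (nat -> V) -> V) : DF t -> DF (fun e => fst_pr (t e)).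
Proof. apply DF_sub1; unfold fst_pr; dp. Qed.

Lemma DF_snd_pr (t : (nat -> V) -> V) : DF t -> DF (fun e => snd_pr (t e)).
Proof. apply DF_sub1; unfold snd_pr; dp. Qed.

Lemma img_ext (f g : V -> V) K : (forall i, i ∈ K -> f i = g i) -> img f K = img g K.
Proof.
  intros H; unfold img; f_equal; apply functional_extensionality; intros y.
  apply propositional_extensionality; split; intros [x [Hx ->]]; exists x; rewrite H; auto.
Qed.

Ltac dp_local ::= first [simple apply DF_app | simple apply DF_fst_pr | simple apply DF_snd_pr].

Lemma check_exists : exists C : V -> V, D2 (fun k y => y = C k) /\
  forall k, C k = nm (img C k).
Proof.
  destruct (@recursion M hM (fun k => k)) with (G := fun k h : V => nm (img (app h) k))
    as [C [DC HC]]; [d2|exact (@in_induction M hM)|dp|].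
  exists C; split; [exact DC|]; intros k; rewrite HC at 1; f_equal.
  apply img_ext; intros i Hi; apply app_img; auto.
Qed.

(** The standard names of sets. They serve as labels because distinct sets have names that no
    nonempty injection forces equal. *)
Definition check : V -> V := epsilon (inhabits (fun x => x))
  (fun C => D2 (fun k y => y = C k) /\ forall k, C k = nm (img C k)).

Lemma check_def : D2 (fun k y => y = check k).
Proof. exact (proj1 (epsilon_spec _ _ check_exists)). Qed.

Lemma check_eq k : check k = nm (img check k).
Proof. exact (proj2 (epsilon_spec _ _ check_exists) k). Qed.

(** Two singletons are needed: the sole member of a label is then nonempty, so that a set containing
    the empty set differs from every label. Both [check k] and its singleton may contain the empty
    set. *)
Definition label (k : V) : V := nm (sgl (nm (sgl (check k)))).

Lemma DF_label (t : (nat -> V) -> V) : DF t -> DF (fun e => label (t e)).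
Proof. intros H; unfold label; pose proof check_def; dp. Qed.

Definition upd (s x n : V) : V :=
  cup (sep s (fun p => ~ exists y, p = pr x y)) (sgl (pr x n)).

Lemma pr_upd s x n y c : pr y c ∈ upd s x n <-> (y = x /\ c = n) \/ (y <> x /\ pr y c ∈ s).
Proof.
  unfold upd; rewrite in_cup, in_sgl, in_sep by d1; split.
  - intros [[H K] | E]; [|left; apply pr_inj; exact E].
    right; split; [|exact H]; intros ->; apply K; eauto.
  - intros [[-> ->] | [N H]]; [auto|]; left; split; [exact H|].
    intros [z E]; apply pr_inj in E; tauto.
Qed.

Lemma rel_upd s x n y c : rel (upd s x n) y c <-> (y = x /\ c = n) \/ (y <> x /\ rel s y c).
Proof. rewrite !rel_iff; apply pr_upd. Qed.

Lemma DF_upd (s t u : (nat -> V) -> V) : DF s -> DF t -> DF u ->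
  DF (fun e => upd (s e) (t e) (u e)).
Proof. apply DF_sub3; unfold upd; dp. Qed.

(** The key [<u, <s, b>>] stands for the assertion that the formula [u] is true
    (if [b] is empty) or false (otherwise) when each variable [x] is interpreted
    as the value of the generic function at the number [s x]. *)
Definition key (u s b : V) : V := pr u (pr s b).

Lemma key_inj u s b u' s' b' : key u s b = key u' s' b' -> u = u' /\ s = s' /\ b = b'.
Proof.
  intros H; apply pr_inj in H; destruct H as [-> H]; apply pr_inj in H; tauto.
Qed.

Lemma DF_key (s t u : (nat -> V) -> V) : DF s -> DF t -> DF u ->
  DF (fun e => key (s e) (t e) (u e)).
Proof. intros; unfold key; dp. Qed.

Definition flip (b : V) : V := if dec (b = emp) then sgl emp else emp.

Lemma sgl_emp x : sgl x <> emp.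
Proof. intros H; apply (in_emp x); rewrite <- H; apply in_sgl; auto. Qed.

Lemma flip_emp : flip emp = sgl emp.
Proof. unfold flip; destruct dec; tauto. Qed.

Lemma flip_sgl x : flip (sgl x) = emp.
Proof. unfold flip; destruct dec as [H|]; [destruct (sgl_emp _ H) | reflexivity]. Qed.

Lemma DF_flip (t : (nat -> V) -> V) : DF t -> DF (fun e => flip (t e)).
Proof. intros; unfold flip; dp. Qed.

Ltac dp_names ::= first [simple apply DF_label | simple apply DF_upd | simple apply DF_key
  | simple apply DF_flip].

Definition kid (i k : V) : Prop := exists u s b, k = key u s b /\
  ((exists v, tagged 3 u v /\ i = key v s (flip b)) \/
   (exists Phi v, tagged 4 u Phi /\ v ∈ Phi /\ i = key v s b) \/
   (exists x v n, tagged2 5 u x v /\ is_nat n /\ i = key v (upd s x n) b)).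

Definition kids (k : V) : V := setof (fun i => kid i k).

Lemma kids_def : D2 (fun k K => K = kids k).
Proof. unfold kids, kid; d2. Qed.

Lemma kid_key i u s b : kid i (key u s b) <->
  ((exists v, tagged 3 u v /\ i = key v s (flip b)) \/
   (exists Phi v, tagged 4 u Phi /\ v ∈ Phi /\ i = key v s b) \/
   (exists x v n, tagged2 5 u x v /\ is_nat n /\ i = key v (upd s x n) b)).
Proof.
  split; [|intros H; exists u, s, b; auto].
  intros [u' [s' [b' [E H]]]]; apply key_inj in E; destruct E as [-> [-> ->]]; exact H.
Qed.

Lemma kid_neg i u v s b : tagged 3 u v -> (kid i (key u s b) <-> i = key v s (flip b)).
Proof.
  intros H; rewrite kid_key, tagged_iff in *; subst u; split.
  - intros [[v' [E ->]] | [[Phi [v' [E _]]] | [x [v' [n [E _]]]]]].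
    + apply tagged_iff, tagged_inj in E; destruct E; subst; reflexivity.
    + apply tagged_iff, tagged_inj in E; destruct E; discriminate.
    + apply tagged2_iff, tagged_inj in E; destruct E; discriminate.
  - intros ->; left; exists v; rewrite tagged_iff; auto.
Qed.

Lemma kid_conj i u Phi s b : tagged 4 u Phi ->
  (kid i (key u s b) <-> exists v, v ∈ Phi /\ i = key v s b).
Proof.
  intros H; rewrite kid_key, tagged_iff in *; subst u; split.
  - intros [[v' [E ->]] | [[Phi' [v' [E H]]] | [x [v' [n [E _]]]]]].
    + apply tagged_iff, tagged_inj in E; destruct E; discriminate.
    + apply tagged_iff, tagged_inj in E; destruct E; subst; eauto.
    + apply tagged2_iff, tagged_inj in E; destruct E; discriminate.
  - intros [v [Hv ->]]; right; left; exists Phi, v; rewrite tagged_iff; auto.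
Qed.

Lemma kid_all i u x v s b : tagged2 5 u x v ->
  (kid i (key u s b) <-> exists n, is_nat n /\ i = key v (upd s x n) b).
Proof.
  intros H; rewrite kid_key, tagged2_iff in *; subst u; split.
  - intros [[v' [E ->]] | [[Phi' [v' [E H]]] | [x' [v' [n [E H]]]]]].
    + apply tagged_iff, tagged_inj in E; destruct E; discriminate.
    + apply tagged_iff, tagged_inj in E; destruct E; discriminate.
    + apply tagged2_iff, tagged_inj in E; destruct E as [_ E]; apply pr_inj in E.
      destruct E; subst; eauto.
  - intros [n [Hn ->]]; right; right; exists x, v, n; rewrite tagged2_iff; auto.
Qed.

(** The children form a set: a conjunction branches over the set [Phi], and a quantifier over [om]
    instead of [V]. This is where the generic enumeration makes the recursion possible. *)
Lemma in_kids i k : i ∈ kids k <-> kid i k.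
Proof.
  apply (in_setof (P := fun i => kid i k)).
  destruct (classic (exists u s b, k = key u s b /\
    ((exists v, tagged 3 u v) \/ (exists Phi, tagged 4 u Phi) \/ (exists x v, tagged2 5 u x v))))
    as [[u [s [b [-> H]]]] | N].
  - destruct H as [[v H] | [[Phi H] | [x [v H]]]].
    + exists (sgl (key v s (flip b))); intros j; rewrite in_sgl, kid_neg by eassumption; tauto.
    + exists (img (fun v => key v s b) Phi); intros j.
      rewrite in_img, kid_conj by (eassumption || d2); reflexivity.
    + exists (img (fun n => key v (upd s x n) b) om); intros j.
      rewrite in_img, kid_all by (eassumption || d2).
      split; intros [n [Hn E]]; exists n; rewrite in_om in *; auto.
  - exists emp; intros j; rewrite in_emp; split; [tauto|].
    intros [u [s [b [-> H]]]]; apply N; exists u, s, b; split; [reflexivity|].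
    destruct H as [[v [H _]] | [[Phi [v [H _]]] | [x [v [n [H _]]]]]]; eauto 6.
Qed.

Lemma formula_induction (P : V -> Prop) : D1 P ->
  (forall u, (forall v, tagged 3 u v -> P v) ->
     (forall Phi v, tagged 4 u Phi -> v ∈ Phi -> P v) ->
     (forall x v, tagged2 5 u x v -> P v) -> P u) -> forall u, P u.
Proof.
  intros HP H; by_ind (@deep_induction M hM); intros u IH; apply H.
  - intros v Hv; apply tagged_iff in Hv; subst u.
    destruct (pr_right (tg 3) v) as [z [Hz Kz]]; exact (proj1 (IH z Hz v Kz)).
  - intros Phi v Hp Hv; apply tagged_iff in Hp; subst u.
    destruct (pr_right (tg 4) Phi) as [z [Hz Kz]].
    exact (proj1 (proj2 (IH z Hz Phi Kz) v Hv)).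
  - intros x v Hv; apply tagged2_iff in Hv; subst u.
    destruct (pr_right (tg 5) (pr x v)) as [z [Hz Kz]], (pr_right x v) as [w [Hw Kw]].
    exact (proj2 (proj2 (IH z Hz (pr x v) Kz) w Hw) v Kw).
Qed.

Lemma kids_ind (Q : V -> Prop) : D1 Q ->
  (forall k, (forall i, i ∈ kids k -> Q i) -> Q k) -> forall k, Q k.
Proof.
  intros HQ H k; apply H; intros i Hi; apply in_kids in Hi.
  (* Every child is a key. Quantifiers change the assignment and negations the truth value, so the
     induction runs on the formula alone, with [s] and [b] arbitrary. *)
  enough (K : forall u s b, Q (key u s b)).
  { destruct Hi as [u [s [b [-> Hi]]]].
    destruct Hi as [[v [_ ->]] | [[Phi [v [_ [_ ->]]]] | [x [v [n [_ [_ ->]]]]]]]; apply K. }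
  by_ind formula_induction; intros u H3 H4 H5 s b; apply H; intros j Hj.
  apply in_kids, kid_key in Hj.
  destruct Hj as [[v [E ->]] | [[Phi [v [E [L ->]]]] | [x [v [n [E [_ ->]]]]]]]; eauto.
Qed.

(** Since the generic function is injective, [x = y] is decided by the
    assignment [s] alone, whence the condition [top] in that case. *)
Definition lit (u s r : V) : Prop :=
  (exists x y n, tagged2 0 u x y /\ rel s x n /\ rel s y n /\ r = top) \/
  (exists x y n m, tagged2 1 u x y /\ rel s x n /\ rel s y m /\ is_nat n /\ is_nat m /\
     r = ec n m) \/
  (exists x n, tagged 2 u x /\ rel s x n /\ is_nat n /\ r = ac n).

Definition lits (k : V) : V := setof (fun r => exists u s b, k = key u s b /\ lit u s r).

Lemma in_lits u s b r : r ∈ lits (key u s b) <-> lit u s r.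
Proof.
  unfold lits; rewrite in_setof.
  - split; [|intros H; exists u, s, b; auto].
    intros [u' [s' [b' [E H]]]]; apply key_inj in E; destruct E as [-> [-> _]]; exact H.
  - apply (@small_sub M hM _ (cup (sgl top)
      (cup (uni (img (fun n => img (fun m => ec n m) om) om)) (img ac om)))).
    + unfold lit, ec, ac; d1.
    + intros r' [u' [s' [b' [_ [H | [H | H]]]]]]; rewrite !in_cup, in_sgl.
      * destruct H as [x [y [n H]]]; left; tauto.
      * destruct H as [x [y [n [m [_ [_ [_ [Hn [Hm ->]]]]]]]]]; right; left.
        apply in_uni; exists (img (fun m => ec n m) om); rewrite !in_img by (unfold ec; d2).
        split; [exists n | exists m]; rewrite in_om; auto.
      * destruct H as [x [n [_ [_ [Hn ->]]]]]; right; right; rewrite in_img by (unfold ac; d2).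
        exists n; rewrite in_om; auto.
Qed.

Lemma lits_cond k r : r ∈ lits k -> FA_cond r.
Proof.
  destruct (classic (exists u s b, k = key u s b)) as [[u [s [b ->]]] | N]; intros H.
  - apply in_lits in H; destruct H as [H | [H | H]].
    + destruct H as [x [y [n [_ [_ [_ ->]]]]]]; apply top_cond.
    + destruct H as [x [y [n [m [_ [_ [_ [Hn [Hm ->]]]]]]]]]; right; left; exists n, m.
      apply ec_cond; auto.
    + destruct H as [x [n [_ [_ [Hn ->]]]]]; right; right; exists n; apply ac_cond; auto.
  - unfold lits in H; rewrite in_setof in H.
    + destruct H as [u [s [b [E _]]]]; destruct N; eauto.
    + exists emp; intros y; rewrite in_emp; split; [tauto|].
      intros [u [s [b [E _]]]]; destruct N; eauto.
Qed.

Lemma DF_kids (t : (nat -> V) -> V) : DF t -> DF (fun e => kids (t e)).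
Proof. apply DF_D2, kids_def. Qed.

Lemma DF_lits (t : (nat -> V) -> V) : DF t -> DF (fun e => lits (t e)).
Proof. apply DF_sub1; unfold lits, lit, ec, ac; dp. Qed.

Definition atomic (u : V) : Prop :=
  exists x y, tagged2 0 u x y \/ tagged2 1 u x y \/ tagged 2 u x.

(** A marker for atomic truth: [lit_name k] contains [unit] exactly when a condition in [lits k] is
    met. So the equation of [lit_name k] with the name of the base plus [unit] says that the atom is
    true, and with that of the base alone that it is false. *)
Definition unit : V := nm (sgl emp).
(** With [emp] as a member, the names built on the base differ from [emp] and from all labels;
    [label k] tells the key. *)
Definition base (k : V) : V := up emp (label k).
Definition lit_name (k : V) : V := cup (nm (base k)) (img (fun r => pr unit r) (lits k)).
(** [some_name s t K j] is [all_name s K] with [t j] in place of [s j], so for names that are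
    otherwise apart the two are equal iff [s j] equals [t j]. The member [emp] distinguishes both
    from the members of the base. *)
Definition all_name (s : V -> V) (K : V) : V := nm (cup (sgl emp) (img s K)).
Definition some_name (s t : V -> V) (K j : V) : V :=
  nm (cup (sgl emp) (img (fun i => if dec (i = j) then t i else s i) K)).

(** Given names [s i], [t i] whose equality expresses [i], for each child [i] of
    [k], a pair of names whose equality expresses [k].  The element [label k]
    prevents equalities between names belonging to different keys. *)
Definition gadget (k : V) (s t : V -> V) : V :=
  if dec (exists u a b, k = key u a b /\ atomic u) then
    pr (nm (if dec (exists u a, k = key u a emp) then cup (base k) (sgl unit) else base k))
       (lit_name k)
  else if dec (exists u a, k = key u a emp) then
    pr (nm (cup (base k) (img s (kids k)))) (nm (cup (base k) (img t (kids k))))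
  else
    pr (nm (cup (base k) (cup (sgl (all_name s (kids k))) (img (some_name s t (kids k)) (kids k)))))
       (nm (cup (base k) (img (some_name s t (kids k)) (kids k)))).

(** Needed to turn the recursion, which looks names up in a table for the children, into an equation
    about the solution itself. *)
Lemma gadget_ext k s t s' t' :
  (forall i, i ∈ kids k -> s i = s' i /\ t i = t' i) -> gadget k s t = gadget k s' t'.
Proof.
  intros H; unfold gadget.
  assert (E : forall j, some_name s t (kids k) j = some_name s' t' (kids k) j).
  { intros j; unfold some_name; do 2 f_equal; apply img_ext; intros i Hi.
    destruct (H i Hi) as [-> ->]; reflexivity. }
  replace (img (some_name s t (kids k)) (kids k)) with (img (some_name s' t' (kids k)) (kids k))
    by (apply img_ext; intros; symmetry; apply E).
  replace (img s (kids k)) with (img s' (kids k)) by (apply img_ext; intros i Hi; symmetry; apply H, Hi).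
  replace (img t (kids k)) with (img t' (kids k)) by (apply img_ext; intros i Hi; symmetry; apply H, Hi).
  replace (all_name s (kids k)) with (all_name s' (kids k)); [reflexivity|].
  unfold all_name; do 2 f_equal; apply img_ext; intros i Hi; symmetry; apply H, Hi.
Qed.

Ltac dp_local ::= first [simple apply DF_app | simple apply DF_fst_pr | simple apply DF_snd_pr
  | simple apply DF_kids | simple apply DF_lits].

Lemma names_exist : exists N : V -> V, D2 (fun k y => y = N k) /\
  forall k, N k = gadget k (fun i => fst_pr (N i)) (fun i => snd_pr (N i)).
Proof.
  destruct (@recursion M hM kids kids_def kids_ind
    (fun k h => gadget k (fun i => fst_pr (app h i)) (fun i => snd_pr (app h i))))
    as [N [DN HN]].
  - unfold gadget, lit_name, all_name, some_name, base, unit, atomic; dp.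
  - exists N; split; [exact DN|]; intros k; rewrite HN at 1; apply gadget_ext.
    intros i Hi; rewrite app_img; auto.
Qed.

Definition key_name : V -> V := epsilon (inhabits (fun x => x))
  (fun N => D2 (fun k y => y = N k) /\
     forall k, N k = gadget k (fun i => fst_pr (N i)) (fun i => snd_pr (N i))).

Definition sig (k : V) : V := fst_pr (key_name k).
Definition tau (k : V) : V := snd_pr (key_name k).

Lemma key_name_def : D2 (fun k y => y = key_name k).
Proof. exact (proj1 (epsilon_spec _ _ names_exist)). Qed.

Lemma key_name_eq k : key_name k = gadget k sig tau.
Proof. exact (proj2 (epsilon_spec _ _ names_exist) k). Qed.

Lemma DF_sig (t : (nat -> V) -> V) : DF t -> DF (fun e => sig (t e)).
Proof. intros; pose proof key_name_def; unfold sig; dp. Qed.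

Lemma DF_tau (t : (nat -> V) -> V) : DF t -> DF (fun e => tau (t e)).
Proof. intros; pose proof key_name_def; unfold tau; dp. Qed.

End Codes.

Ltac dp_names ::= first [simple apply DF_label | simple apply DF_upd | simple apply DF_key
  | simple apply DF_flip | simple apply DF_lits | simple apply DF_sig | simple apply DF_tau].

(** * Forcing the keys *)

Section KeyNames.
Context {M : structure} {hM : GBC M}.
Notation V := (vset M).
Context (A : vclass M) (Fin Fsub Feq : vclass M).
Context (HF : is_atomic_forcing FA_cond (FA_le A) Fin Fsub Feq).
Notation name := (is_name (@FA_cond M)).
Notation below := (below A).
Notation FE := (FE Feq).
Notation FI := (FI Fin).
Notation apart := (apart Feq).

Hint Resolve subset_refl : core.

Lemma name_emp : name emp.
Proof. apply name_intro; intros u Hu; apply in_emp in Hu; tauto. Qed.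

Lemma names_sgl x : name x -> names (sgl x).
Proof. intros H y Hy; apply in_sgl in Hy; subst; exact H. Qed.

Lemma names_cup S T : names S -> names T -> names (cup S T).
Proof. intros H K y Hy; apply in_cup in Hy; destruct Hy; auto. Qed.

Lemma names_img (f : V -> V) K : D2 (fun i y => y = f i) ->
  (forall i, i ∈ K -> name (f i)) -> names (img f K).
Proof. intros D H y Hy; rewrite in_img in Hy by exact D; destruct Hy as [i [Hi ->]]; auto. Qed.

Lemma name_check k : name (check k).
Proof.
  revert k; pose proof check_def as D; by_ind (@in_induction M hM); intros k IH.
  rewrite check_eq; apply name_nm, names_img; auto.
Qed.

Lemma name_label k : name (label k).
Proof. unfold label; auto using name_nm, names_sgl, name_check. Qed.

Lemma name_unit : name unit.
Proof. unfold unit; auto using name_nm, names_sgl, name_emp. Qed.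

Lemma names_base k : names (base k).
Proof.
  intros y Hy; unfold base in Hy; apply in_up in Hy.
  destruct Hy; subst; [apply name_emp | apply name_label].
Qed.

Hint Resolve name_emp names_sgl names_cup name_check name_label name_unit names_base name_nm : core.

Lemma name_lit_name k : name (lit_name k).
Proof.
  apply name_intro; intros u Hu; unfold lit_name in Hu.
  rewrite in_cup, in_img in Hu by d2; destruct Hu as [Hu | [r [Hr ->]]].
  - apply name_elim with (nm (base k)); auto.
  - exists unit, r; split; [|split]; auto; exact (lits_cond _ _ Hr).
Qed.

Lemma some_name_def k : D2 (fun j y => y = some_name sig tau (kids k) j).
Proof. unfold some_name; d2. Qed.

Lemma name_all K : (forall i, i ∈ K -> name (sig i)) -> name (all_name sig K).
Proof.
  intros H; unfold all_name; apply name_nm, names_cup; auto; apply names_img; [d2 | exact H].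
Qed.

Lemma name_some K j : (forall i, i ∈ K -> name (sig i) /\ name (tau i)) ->
  name (some_name sig tau K j).
Proof.
  intros H; unfold some_name; apply name_nm, names_cup; auto; apply names_img; [d2|].
  intros i Hi; destruct dec; apply H, Hi.
Qed.

Lemma key_names k : name (sig k) /\ name (tau k).
Proof.
  revert k; by_ind (@kids_ind M hM); intros k IH; unfold sig, tau; rewrite key_name_eq.
  assert (Ns : names (img sig (kids k))) by (apply names_img; [d2 | apply IH]).
  assert (Nt : names (img tau (kids k))) by (apply names_img; [d2 | apply IH]).
  assert (Na : name (all_name sig (kids k))) by (apply name_all; apply IH).
  assert (Ny : names (img (some_name sig tau (kids k)) (kids k))).
  { apply names_img; [apply some_name_def|]; intros; apply name_some, IH. }
  unfold gadget; destruct dec; [|destruct dec]; rewrite fst_pr_eq, snd_pr_eq; auto 7.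
  split; [destruct dec; auto | apply name_lit_name].
Qed.

Lemma name_sig k : name (sig k). Proof. apply key_names. Qed.
Lemma name_tau k : name (tau k). Proof. apply key_names. Qed.
Hint Resolve name_sig name_tau : core.

Definition zeroed (w : V) : Prop := forall f, good f -> FI f emp w.

(** The invariant behind apartness: a name of the key [k] contains the label of [k] and no other
    label, so its key can be read off. The empty set as a member separates it from labels. *)
Record shape (k w : V) : Prop := {
  shape_name : name w;
  shape_zero : zeroed w;
  shape_label : forall f, good f -> FI f (label k) w;
  shape_other : forall j f, j <> k -> good f -> ~ FI f (label j) w
}.

Lemma not_in_emp f s : good f -> name s -> ~ FI f s emp.
Proof.
  intros Hf Hs H; apply (FI_iff HF) in H; auto.
  destruct (dense_ex Hf H) as [g [_ [_ [u [r [K _]]]]]]; exact (rel_emp K).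
Qed.

Lemma inhabited_apart_emp s u : name s -> name u -> (forall f, good f -> FI f u s) -> apart s emp.
Proof.
  intros Hs Hu H f Hf E; apply (@not_in_emp f u); auto.
  apply (FI_congr HF (t := s)); auto.
Qed.

Lemma zeroed_nm S : names S -> emp ∈ S -> zeroed (nm S).
Proof. intros H K f Hf; apply (FI_in HF); auto. Qed.

Lemma nm_sgl_inj f s t : good f -> name s -> name t -> FE f (nm (sgl s)) (nm (sgl t)) -> FE f s t.
Proof.
  intros Hf Hs Ht H; apply (FE_iff HF) in H; auto; destruct H as [H _].
  apply (FS_nm HF) with (s := s) in H; auto; [|apply in_sgl; reflexivity].
  apply (@FI_nm_one _ _ _ _ _ _ HF f s (sgl t) t); auto.
  - apply in_sgl; reflexivity.
  - intros u Hu; apply in_sgl in Hu; tauto.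
Qed.

(** Some [z] lies in just one of the two sets, and inductively [check z] is apart from the names of
    all members of the other one. *)
Lemma check_apart x : forall y, x <> y -> apart (check x) (check y).
Proof.
  revert x; pose proof check_def as D; unfold apart; by_ind (@in_induction M hM).
  intros x IH y N f Hf E.
  assert (Nx : forall x, names (img check x)) by (intros; apply names_img; auto).
  assert (K : exists z, (z ∈ x /\ ~ z ∈ y) \/ (z ∈ y /\ ~ z ∈ x)).
  { apply NNPP; intros K; apply N, ext; intros z; split; intros Hz; apply NNPP; intros L; apply K; exists z; auto. }
  destruct K as [z K]; rewrite (check_eq x), (check_eq y) in E.
  apply (FE_iff HF) in E; auto; rewrite !(FS_nm HF) in E; auto; destruct E as [E E'].
  destruct K as [[Hz Hz'] | [Hz Hz']].
  - apply (@FI_nm_apart _ _ _ _ _ _ HF f (check z) (img check y)); auto.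
    + intros u Hu; rewrite in_img in Hu by exact D; destruct Hu as [w [Hw ->]].
      intros g Hg; apply IH; auto; intros ->; auto.
    + apply E; rewrite in_img by exact D; eauto.
  - apply (@FI_nm_apart _ _ _ _ _ _ HF f (check z) (img check x)); auto.
    + intros u Hu; rewrite in_img in Hu by exact D; destruct Hu as [w [Hw ->]].
      (* The induction is on [x] only. Here [z] belongs to [y], so the hypothesis is applied to the
         member [w] of [x] and the result is turned around. *)
      apply (apart_sym HF); auto; intros g Hg; apply IH; auto; intros ->; auto.
    + apply E'; rewrite in_img by exact D; eauto.
Qed.

Lemma label_apart j k : j <> k -> apart (label j) (label k).
Proof.
  intros N f Hf E; apply (check_apart N Hf); unfold label in E.
  apply nm_sgl_inj in E; auto; apply nm_sgl_inj in E; auto.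
Qed.

Lemma label_apart_emp k : apart (label k) emp.
Proof.
  apply inhabited_apart_emp with (nm (sgl (check k))); auto.
  intros f Hf; apply (FI_in HF); auto; apply in_sgl; reflexivity.
Qed.

(** Equality would put the empty set into the label, whose only member is nonempty. *)
Lemma zeroed_apart_label k w : name w -> zeroed w -> apart w (label k).
Proof.
  intros Hw Z f Hf E; assert (K := FI_congr HF Hf name_emp Hw (name_label k) E (Z f Hf)).
  apply (FI_nm_apart HF Hf) in K; auto; intros u Hu; apply in_sgl in Hu; subst u.
  apply (apart_sym HF); auto; apply inhabited_apart_emp with (check k); auto.
  intros g Hg; apply (FI_in HF); auto; apply in_sgl; reflexivity.
Qed.

Lemma zeroed_apart_emp w : name w -> zeroed w -> apart w emp.
Proof. intros; apply inhabited_apart_emp with emp; auto. Qed.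

(** A foreign label cannot become a member: it differs from [emp], from [label k], and from every
    set that contains the empty set. *)
Lemma shape_intro k w : name w -> rel w emp top -> rel w (label k) top ->
  (forall s r, rel w s r -> s = emp \/ s = label k \/ zeroed s) -> shape k w.
Proof.
  intros Hw He Hl H; split; [exact Hw| | |].
  - intros f Hf; apply (FI_iff HF); auto; apply dense_all; intros g Hg _.
    exists emp, top; split; [exact He | split; [apply below_top, Hg | apply (FE_refl HF); auto]].
  - intros f Hf; apply (FI_iff HF); auto; apply dense_all; intros g Hg _.
    exists (label k), top; split; [exact Hl | split; [apply below_top, Hg|]].
    apply (FE_refl HF); auto.
  - intros j f N Hf K; apply (FI_iff HF) in K; auto.
    destruct (dense_ex Hf K) as [g [Hg [_ [s [r [Hs [_ E]]]]]]].
    destruct (name_rel Hw Hs) as [Ns _].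
    destruct (H s r Hs) as [-> | [-> | Z]].
    + exact (label_apart_emp j Hg E).
    + exact (label_apart N Hg E).
    + apply (zeroed_apart_label j Ns Z Hg), (FE_sym HF); auto.
Qed.

Lemma shape_nm k S : names S -> (forall s, s ∈ S -> zeroed s) -> shape k (nm (cup (base k) S)).
Proof.
  intros HS Z; apply shape_intro; auto.
  - apply rel_nm; unfold base; rewrite in_cup, in_up; auto.
  - apply rel_nm; unfold base; rewrite in_cup, in_up; auto.
  - intros s r H; apply rel_nm in H; unfold base in H; rewrite in_cup, in_up in H.
    destruct H as [[[H | H] | H] _]; auto.
Qed.

Lemma zeroed_unit : zeroed unit.
Proof. apply zeroed_nm; auto; apply in_sgl; reflexivity. Qed.

Lemma rel_lit_name k s r : rel (lit_name k) s r <->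
  (s ∈ base k /\ r = top) \/ (s = unit /\ r ∈ lits k).
Proof.
  rewrite <- rel_nm, !rel_iff; unfold lit_name; rewrite in_cup, in_img by d2.
  split; (intros [H | H]; [auto|]).
  - destruct H as [x [Hx E]]; apply pr_inj in E; destruct E; subst; auto.
  - destruct H as [-> H]; eauto.
Qed.

Lemma names_some k : names (img (some_name sig tau (kids k)) (kids k)).
Proof. apply names_img; [apply some_name_def|]; intros; apply name_some; auto. Qed.

Lemma zeroed_all K : zeroed (all_name sig K).
Proof.
  apply zeroed_nm; [apply names_cup; auto; apply names_img; auto; d2|].
  rewrite in_cup, in_sgl; auto.
Qed.

Lemma zeroed_some K j : zeroed (some_name sig tau K j).
Proof.
  apply zeroed_nm; [apply names_cup; auto; apply names_img; [d2|]|].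
  - intros i _; destruct dec; auto.
  - rewrite in_cup, in_sgl; auto.
Qed.

Lemma gadget_zeroed k : zeroed (sig k) /\ zeroed (tau k).
Proof.
  unfold sig, tau; rewrite key_name_eq.
  assert (Z : forall S, names S -> zeroed (nm (cup (base k) S))).
  { intros S HS; apply zeroed_nm; auto; unfold base; rewrite in_cup, in_up; auto. }
  assert (Na : name (all_name sig (kids k))) by (apply name_all; auto).
  assert (Ny := names_some k).
  unfold gadget; destruct dec; [|destruct dec]; rewrite fst_pr_eq, snd_pr_eq.
  - split.
    + destruct dec; [auto|]; apply zeroed_nm; auto; unfold base; rewrite in_up; auto.
    + intros f Hf; apply (FI_iff HF); auto using name_lit_name; apply dense_all; intros g Hg _.
      exists emp, top; split; [|split; [apply below_top, Hg | apply (FE_refl HF); auto]].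
      apply rel_lit_name; left; unfold base; rewrite in_up; auto.
  - split; apply Z, names_img; auto; d2.
  - split; apply Z; auto.
Qed.

Lemma key_shape k : shape k (sig k) /\ shape k (tau k).
Proof.
  assert (Na : name (all_name sig (kids k))) by (apply name_all; auto).
  assert (Ny := names_some k).
  assert (Zy : forall s, s ∈ img (some_name sig tau (kids k)) (kids k) -> zeroed s).
  { intros s Hs; rewrite in_img in Hs by apply some_name_def; destruct Hs as [j [_ ->]].
    apply zeroed_some. }
  unfold sig, tau; rewrite key_name_eq.
  unfold gadget; destruct dec; [|destruct dec]; rewrite fst_pr_eq, snd_pr_eq.
  - split.
    + destruct dec.
      * apply shape_nm; auto; intros s Hs; apply in_sgl in Hs; subst; apply zeroed_unit.
      * apply shape_intro; auto; try (apply rel_nm; unfold base; rewrite in_up; auto).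
        intros s r H; apply rel_nm in H; unfold base in H; rewrite in_up in H; tauto.
    + apply shape_intro; [apply name_lit_name| | |].
      * apply rel_lit_name; left; unfold base; rewrite in_up; auto.
      * apply rel_lit_name; left; unfold base; rewrite in_up; auto.
      * intros s r H; apply rel_lit_name in H; unfold base in H; rewrite in_up in H.
        destruct H as [H | [-> _]]; [tauto|]; right; right; apply zeroed_unit.
  - split; (apply shape_nm; [apply names_img; auto; d2|]); intros s Hs;
      rewrite in_img in Hs by d2; destruct Hs as [i [_ ->]]; apply gadget_zeroed.
  - split; apply shape_nm; auto.
    intros s Hs; rewrite in_cup, in_sgl in Hs; destruct Hs as [-> | Hs]; auto.
    apply zeroed_all.
Qed.

(** Equality would make the label of [i] a member of [w]. *)
Lemma shape_apart i j v w : i <> j -> shape i v -> shape j w -> apart v w.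
Proof.
  intros N Hv Hw f Hf E; apply (shape_other Hw N Hf), (FI_congr HF (t := v)); auto;
    try apply Hv; try apply Hw; auto.
Qed.

Lemma shape_apart_base i k w u : shape i w -> u ∈ base k -> apart w u.
Proof.
  intros Hw Hu; unfold base in Hu; apply in_up in Hu; destruct Hu as [-> | ->].
  - apply zeroed_apart_emp; apply Hw.
  - apply zeroed_apart_label; apply Hw.
Qed.

Definition holds (k f : V) : Prop := FE f (sig k) (tau k).

Lemma DP_holds (s t : (nat -> V) -> V) : DF s -> DF t -> DP (fun e => holds (s e) (t e)).
Proof. intros; unfold holds; dp. Qed.

Lemma holds_mono k f g : good f -> good g -> subset f g -> holds k f -> holds k g.
Proof. intros Hf Hg L; apply (FE_mono HF); auto. Qed.

Lemma holds_dense k f : good f -> dense f (holds k) -> holds k f.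
Proof. intros Hf H; apply (FE_dense HF); auto. Qed.

(** The conjunction gadget over the children; it applies because distinct children have distinct
    labels. *)
Lemma holds_true u s f : ~ atomic u -> good f ->
  (holds (key u s emp) f <-> forall i, kid i (key u s emp) -> holds i f).
Proof.
  intros Na Hf; unfold holds at 1; unfold sig, tau; rewrite key_name_eq; unfold gadget.
  destruct dec as [[u' [a [b [E H]]]] | _]; [apply key_inj in E; destruct E; subst; tauto|].
  destruct dec as [_ | []]; [|eauto]; rewrite fst_pr_eq, snd_pr_eq.
  rewrite (conj_gadget HF); auto; [|d2|d2| |].
  - split; intros H i Hi; apply H, in_kids, Hi.
  - intros i u' Hi Hu; split; eapply shape_apart_base; eauto; apply key_shape.
  - intros i j Hi Hj N; eapply shape_apart; eauto; apply key_shape.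
Qed.

(** The equation says that the set of all left names of the children is one of its own modifications
    at a single place. Equality with the modification at [j] means that [j] holds. *)
Lemma holds_false u s f : ~ atomic u -> good f ->
  (holds (key u s (sgl emp)) f <->
   dense f (fun g => exists i, kid i (key u s (sgl emp)) /\ holds i g)).
Proof.
  intros Na Hf; set (k := key u s (sgl emp)); unfold holds at 1; unfold sig, tau.
  rewrite key_name_eq; unfold gadget.
  destruct dec as [[u' [a [b [E H]]]] | _]; [apply key_inj in E; destruct E; subst; tauto|].
  destruct dec as [[u' [a E]] | _].
  { apply key_inj in E; destruct E as [_ [_ E]]; destruct (sgl_emp _ E). }
  rewrite fst_pr_eq, snd_pr_eq, (member_gadget HF); auto using names_some.
  2:{ apply name_all; auto. }
  2:{ intros x Hx; unfold base in Hx; apply in_up in Hx; destruct Hx as [-> | ->].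
      - apply zeroed_apart_emp; [apply name_all; auto | apply zeroed_all].
      - apply zeroed_apart_label; [apply name_all; auto | apply zeroed_all]. }
  (* Both names are sets indexed by the children, so the conjunction gadget applies, now with
     [sgl emp] as common part. Away from [j] the equations are trivial. *)
  assert (Q : forall j g, good g -> j ∈ kids k ->
    (FE g (all_name sig (kids k)) (some_name sig tau (kids k) j) <-> holds j g)).
  { intros j g Hg Hj; unfold all_name, some_name; rewrite (conj_gadget HF); auto; [|d2|d2| | |].
    - unfold holds; split.
      + intros H; specialize (H j Hj); destruct dec; [exact H | tauto].
      + intros H i Hi; destruct dec as [-> | N]; [exact H|]; apply (FE_refl HF); auto.
    - intros i Hi; split; auto; destruct dec; auto.
    - intros i x Hi Hx; apply in_sgl in Hx; subst x; split; [|destruct dec];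
        apply zeroed_apart_emp; auto; apply gadget_zeroed.
    - intros i i' Hi Hi' N; eapply shape_apart; eauto; [apply key_shape|].
      destruct dec; apply key_shape. }
  split; apply dense_imp; intros g Hg L.
  - intros [y [Hy E]]; rewrite in_img in Hy by apply some_name_def; destruct Hy as [j [Hj ->]].
    exists j; split; [apply in_kids, Hj | apply Q; auto].
  - intros [j [Hj H]]; apply in_kids in Hj.
    exists (some_name sig tau (kids k) j); rewrite in_img by apply some_name_def.
    split; [eauto | apply Q; auto].
Qed.

Definition met (u s g : V) : Prop := exists r, lit u s r /\ below g r.

Lemma unit_in_lit_name k f : good f ->
  (FI f unit (lit_name k) <-> dense f (fun g => exists r, r ∈ lits k /\ below g r)).
Proof.
  intros Hf; rewrite (FI_iff HF); auto using name_lit_name.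
  split; apply dense_imp; intros g Hg _.
  - intros [s [r [Hs [B E]]]]; apply rel_lit_name in Hs.
    destruct Hs as [[Hs _] | [-> Hr]]; [|eauto].
    unfold base in Hs; apply in_up in Hs; destruct Hs as [-> | ->].
    + destruct (zeroed_apart_emp name_unit zeroed_unit Hg E).
    + destruct (zeroed_apart_label _ name_unit zeroed_unit Hg E).
  - intros [r [Hr B]]; exists unit, r; split; [apply rel_lit_name; auto|].
    split; [exact B | apply (FE_refl HF); auto].
Qed.

Lemma base_sub_lit_name k f x : good f -> x ∈ base k -> FI f x (lit_name k).
Proof.
  intros Hf Hx; assert (Nx : name x) by (apply (names_base k), Hx).
  apply (FI_iff HF); auto using name_lit_name; apply dense_all; intros g Hg _.
  exists x, top; split; [apply rel_lit_name; auto|].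
  split; [apply below_top, Hg | apply (FE_refl HF); auto].
Qed.

(** The right side is always included in the left one, so the equation reduces to the membership of
    [unit] in [lit_name k]. *)
Lemma holds_atomic u s f : atomic u -> good f ->
  (holds (key u s emp) f <-> dense f (met u s)).
Proof.
  intros Ha Hf; set (k := key u s emp); unfold holds, sig, tau; rewrite key_name_eq; unfold gadget.
  destruct dec as [_ | N]; [|destruct N; exists u, s, emp; auto].
  destruct dec as [_ | []]; [|exists u, s; reflexivity]; rewrite fst_pr_eq, snd_pr_eq.
  rewrite (FE_iff HF); auto using name_lit_name; rewrite (FS_nm HF); auto using name_lit_name.
  assert (Q : FI f unit (lit_name k) <-> dense f (met u s)).
  { rewrite unit_in_lit_name by exact Hf; split; apply dense_imp; intros g _ _;
      intros [r [Hr B]]; exists r; split; auto; apply (in_lits u s emp r); exact Hr. }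
  rewrite <- Q; split.
  - intros [H _]; apply H; rewrite in_cup, in_sgl; auto.
  - intros H; split.
    + intros x Hx; rewrite in_cup, in_sgl in Hx; destruct Hx as [Hx | ->]; [|exact H].
      apply base_sub_lit_name; auto.
    + apply (FS_iff HF); auto using name_lit_name; intros x r Hx g Hg L _.
      apply (FI_in HF); auto; rewrite in_cup, in_sgl; apply rel_lit_name in Hx; tauto.
Qed.

(** Here the left side lacks [unit], so the equation is refuted by any extension that meets a
    literal. *)
Lemma holds_atomic_false u s f : atomic u -> good f ->
  (holds (key u s (sgl emp)) f <-> forall g, good g -> subset f g -> ~ met u s g).
Proof.
  intros Ha Hf; set (k := key u s (sgl emp)); unfold holds, sig, tau.
  rewrite key_name_eq; unfold gadget.
  destruct dec as [_ | N]; [|destruct N; exists u, s, (sgl emp); auto].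
  destruct dec as [[u' [a E]] | _].
  { apply key_inj in E; destruct E as [_ [_ E]]; destruct (sgl_emp _ E). }
  rewrite fst_pr_eq, snd_pr_eq, (FE_iff HF); auto using name_lit_name; split.
  - intros [_ H] g Hg L [r [Hr B]]; rewrite (FS_iff HF) in H; auto using name_lit_name.
    assert (K : FI g unit (nm (base k))).
    { apply (H unit r); auto; apply rel_lit_name; right; split; [reflexivity|].
      apply in_lits, Hr. }
    apply (FI_nm_apart HF Hg) in K; auto; intros x Hx.
    unfold base in Hx; apply in_up in Hx; destruct Hx as [-> | ->].
    + exact (zeroed_apart_emp name_unit zeroed_unit).
    + exact (zeroed_apart_label _ name_unit zeroed_unit).
  - intros H; split.
    + apply (FS_nm HF); auto using name_lit_name; intros x Hx; apply base_sub_lit_name; auto.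
    + apply (FS_iff HF); auto using name_lit_name; intros x r Hx g Hg L B.
      apply rel_lit_name in Hx; destruct Hx as [[Hx _] | [-> Hr]].
      * apply (FI_in HF); auto.
      * destruct (H g Hg L); exists r; split; auto; apply in_lits in Hr; exact Hr.
Qed.

End KeyNames.

(** * Free variables and valuations *)

Section FreeVars.
Context {M : structure} {hM : GBC M}.
Notation V := (vset M).

Lemma tagged2_tagged k (u x y : V) : tagged2 k u x y <-> tagged k u (pr x y).
Proof. rewrite tagged2_iff, tagged_iff; reflexivity. Qed.

Lemma tagged_unique j k (u x y : V) : tagged j u x -> tagged k u y -> j = k /\ x = y.
Proof. rewrite !tagged_iff; intros -> H; apply tagged_inj, H. Qed.

(** For subformulas only inclusions between sets of free variables are kept; these suffice because
    assignments and valuations may be defined on further variables. *)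
Lemma free_vars_cases (u t : V) : free_vars u t ->
  (exists x y, (tagged 0 u (pr x y) \/ tagged 1 u (pr x y)) /\ t = up x y) \/
  (exists x, tagged 2 u x /\ t = up x x) \/
  (exists v, tagged 3 u v /\ free_vars v t) \/
  (exists Phi, tagged 4 u Phi /\ forall v, v ∈ Phi -> exists t', free_vars v t' /\ subset t' t) \/
  (exists x v, tagged 5 u (pr x v) /\ is_ordinal x /\
     exists t', free_vars v t' /\ forall y, y ∈ t' -> y <> x -> y ∈ t).
Proof.
  intros [F [HF Hu]]; destruct (proj2 HF u t Hu) as
    [[x [y [_ [_ [H K]]]]] | [[x [y [_ [_ [H K]]]]] | [[x [_ [H K]]] | [[v [H K]] |
     [[Phi [H [K [L _]]]] | [x [v [t' [Hx [H [K L]]]]]]]]]]].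
  - left; exists x, y; rewrite <- !tagged2_tagged; apply upair_iff in K; auto.
  - left; exists x, y; rewrite <- !tagged2_tagged; apply upair_iff in K; auto.
  - right; left; exists x; apply upair_iff in K; auto.
  - right; right; left; exists v; split; [exact H | exists F; auto].
  - right; right; right; left; exists Phi; split; [exact H|]; intros v Hv.
    destruct (K v Hv) as [t' Ht']; exists t'; split; [exists F; auto|].
    intros x Hx; apply L; eauto.
  - right; right; right; right; exists x, v; rewrite <- tagged2_tagged.
    split; [exact H | split; [exact Hx|]]; exists t'; split; [exists F; auto|].
    intros y Hy N; apply L; auto.
Qed.

Ltac untag := rewrite ?tagged2_tagged in *; repeat match goal with
  | H : tagged ?j ?u _, K : tagged ?k ?u _ |- _ =>
    tryif constr_eq j k then fail else destruct (tagged_unique H K); discriminate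
  end.

Ltac fv_cases H := apply free_vars_cases in H;
  destruct H as [[x' [y' [[T | T] E]]] | [[x' [T E]] | [[v' [T E]] | [[Phi' [T E]] |
    [x' [v' [T [O E]]]]]]]]; untag.

Lemma free_vars_neg (u v t : V) : tagged 3 u v -> free_vars u t -> free_vars v t.
Proof. intros H K; fv_cases K; destruct (tagged_unique H T) as [_ ->]; exact E. Qed.

Lemma free_vars_conj (u Phi v t : V) : tagged 4 u Phi -> v ∈ Phi -> free_vars u t ->
  exists t', free_vars v t' /\ subset t' t.
Proof. intros H Hv K; fv_cases K; destruct (tagged_unique H T) as [_ ->]; auto. Qed.

Lemma free_vars_all (u x v t : V) : tagged2 5 u x v -> free_vars u t -> is_ordinal x /\
  exists t', free_vars v t' /\ forall y, y ∈ t' -> y <> x -> y ∈ t.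
Proof.
  intros H K; fv_cases K; destruct (tagged_unique H T) as [_ L]; apply pr_inj in L.
  destruct L; subst; auto.
Qed.

Lemma formula_cases (u t : V) : free_vars u t -> atomic u \/ (exists v, tagged 3 u v) \/
  (exists Phi, tagged 4 u Phi) \/ (exists x v, tagged2 5 u x v).
Proof.
  intros K; unfold atomic; fv_cases K.
  - left; exists x', y'; rewrite !tagged2_tagged; auto.
  - left; exists x', y'; rewrite !tagged2_tagged; auto.
  - left; exists x', x'; auto.
  - eauto.
  - eauto.
  - right; right; right; exists x', v'; rewrite tagged2_tagged; auto.
Qed.

Lemma not_atomic k (u x : V) : 2 < k -> tagged k u x -> ~ atomic u.
Proof.
  intros Hk H [a [b [K | [K | K]]]]; rewrite ?tagged2_tagged in K;
    destruct (tagged_unique H K); lia.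
Qed.

Lemma DP_free_vars (s t : (nat -> V) -> V) : DF s -> DF t -> DP (fun e => free_vars (s e) (t e)).
Proof.
  apply DP_sub2; unfold free_vars, is_fv_function, is_ordinal, transitive_set, code_eq,
    code_mem, code_inA, code_neg, code_conj, code_all; dp.
Qed.

End FreeVars.

(** * Valuations represented by numbers and finite injections *)

Section Valuations.
Context {M : structure} {hM : GBC M}.
Notation V := (vset M).
Context (A : vclass M).

(** [s] assigns numbers to variables and [p] decides the values of the generic
    function at these numbers. *)
Definition val (s p x b : V) : Prop := exists n, rel s x n /\ rel p n b.

Definition same (s p s' p' : V) : Prop := forall x b, val s p x b <-> val s' p' x b.

(** Under these conditions [val s p] is functional and gives a set to every free variable of [u]. *)
Definition fit (u s p : V) : Prop :=
  good p /\ is_function s /\ (forall x n, rel s x n -> is_nat n /\ in_dom p n) /\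
  exists t, free_vars u t /\ forall x, x ∈ t -> in_dom s x.

Lemma good_function p : good p -> is_function p.
Proof. intros [[H _] _]; exact H. Qed.

Lemma good_inj p x y b : good p -> rel p x b -> rel p y b -> x = y.
Proof. intros [[_ [H _]] _]; apply H. Qed.

Lemma fit_mono u s p q : fit u s p -> good q -> subset p q -> fit u s q.
Proof.
  intros [_ [Hs [Hd Hv]]] Hq L; split; [exact Hq|]; split; [exact Hs|]; split; [|exact Hv].
  intros x n Hn; destruct (Hd x n Hn) as [H [b Hb]]; split; [exact H|].
  exists b; exact (rel_subset L Hb).
Qed.

Lemma same_mono u s p q : fit u s p -> good q -> subset p q -> same s p s q.
Proof.
  intros [_ [Hs [Hd _]]] Hq L x b; split; intros [n [Hn Hb]]; exists n; split; auto.
  - exact (rel_subset L Hb).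
  - destruct (Hd x n Hn) as [_ [c Hc]].
    rewrite (proj2 (good_function Hq) n b c); auto; exact (rel_subset L Hc).
Qed.

Lemma val_upd s x n p b y c : good p -> rel p n b ->
  (val (upd s x n) p y c <-> (y = x /\ c = b) \/ (y <> x /\ val s p y c)).
Proof.
  intros Hp Hb; split.
  - intros [m [Hm Hc]]; apply rel_upd in Hm; destruct Hm as [[-> ->] | [N Hm]].
    + left; split; [reflexivity|]; exact (proj2 (good_function Hp) n c b Hc Hb).
    + right; split; [exact N | exists m; auto].
  - intros [[-> ->] | [N [m [Hm Hc]]]]; [exists n | exists m]; rewrite rel_upd; auto.
Qed.

Lemma same_upd s p s' p' x n n' b : good p -> good p' -> same s p s' p' ->
  rel p n b -> rel p' n' b -> same (upd s x n) p (upd s' x n') p'.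
Proof.
  intros Hp Hp' H Hb Hb' y c; rewrite !val_upd by eassumption; rewrite (H y c); reflexivity.
Qed.

Lemma upd_function s x n : is_function s -> is_function (upd s x n).
Proof.
  intros [Hr Hf]; split.
  - intros p Hp; unfold upd in Hp; rewrite in_cup, in_sgl, in_sep in Hp by d1.
    destruct Hp as [[Hp _] | ->]; [auto|]; exists x, n; apply opair_iff; reflexivity.
  - intros y a b; rewrite !rel_upd; intros [[-> ->] | [N H]] [[E ->] | [N' H']]; try tauto.
    exact (Hf y a b H H').
Qed.

Lemma fit_neg u v s p : tagged 3 u v -> fit u s p -> fit v s p.
Proof.
  intros H [Hp [Hs [Hd [t [Ht Hv]]]]]; split; [|split; [|split]]; auto.
  exists t; split; [exact (free_vars_neg H Ht) | exact Hv].
Qed.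

Lemma fit_conj u Phi v s p : tagged 4 u Phi -> v ∈ Phi -> fit u s p -> fit v s p.
Proof.
  intros H K [Hp [Hs [Hd [t [Ht Hv]]]]]; split; [|split; [|split]]; auto.
  destruct (free_vars_conj v H K Ht) as [t' [Ht' L]]; exists t'; auto.
Qed.

Lemma fit_all u x v s n p : tagged2 5 u x v -> is_nat n -> in_dom p n -> fit u s p ->
  fit v (upd s x n) p.
Proof.
  intros H Hn Dn [Hp [Hs [Hd [t [Ht Hv]]]]]; split; [|split; [|split]]; auto.
  - apply upd_function, Hs.
  - intros y m Hm; apply rel_upd in Hm; destruct Hm as [[-> ->] | [_ Hm]]; eauto.
  - destruct (free_vars_all H Ht) as [_ [t' [Ht' L]]]; exists t'; split; [exact Ht'|].
    intros y Hy; destruct (classic (y = x)) as [-> | N].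
    + exists n; apply rel_upd; auto.
    + destruct (Hv y (L y Hy N)) as [m Hm]; exists m; apply rel_upd; auto.
Qed.

Lemma add_good p n b : is_coll p -> is_nat n -> ~ in_dom p n -> ~ in_ran p b -> good (add p n b).
Proof.
  intros H1 H2 H3 H4; split; [apply coll_add; auto|]; intros E.
  apply (@rel_emp M hM n b); rewrite <- E; apply rel_add; auto.
Qed.

(** Surjectivity of the generic function: a missing value is put at a fresh number. *)
Lemma extend_ran (p b : V) : is_coll p ->
  exists q n, is_coll q /\ subset p q /\ is_nat n /\ rel q n b.
Proof.
  intros Hp; destruct (classic (in_ran p b)) as [[n Hn] | N].
  - exists p, n; split; [exact Hp | split; [apply subset_refl | split; [|exact Hn]]].
    apply Hp; exists b; exact Hn.
  - destruct (@fresh_nat M hM p) as [n [Hn Fn]]; [apply Hp|].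
    exists (add p n b), n; split; [|split; [apply subset_add|]].
    + apply coll_add; auto.
    + split; [exact Hn | apply rel_add; auto].
Qed.

Lemma subset_good (p q : V) : good p -> is_coll q -> subset p q -> good q.
Proof.
  intros [_ N] H L; split; [exact H|]; intros ->; apply N, ext; intros z; rewrite in_emp.
  split; [|tauto]; intros Hz; apply L in Hz; apply in_emp in Hz; exact Hz.
Qed.

Lemma good_extend_ran (p b : V) : good p ->
  exists q n, good q /\ subset p q /\ is_nat n /\ rel q n b.
Proof.
  intros Hp; destruct (extend_ran b (proj1 Hp)) as [q [n [Hq [L H]]]]; exists q, n.
  split; [exact (subset_good Hp Hq L) | auto].
Qed.

(** Totality of the generic function. The new value must lie outside the range to preserve
    injectivity. *)
Lemma good_extend_dom (p n : V) : good p -> is_nat n ->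
  exists q b, good q /\ subset p q /\ rel q n b.
Proof.
  intros Hp Hn; destruct (classic (in_dom p n)) as [[b Hb] | N].
  - exists p, b; split; [exact Hp | split; [apply subset_refl | exact Hb]].
  - destruct (fresh_set (good_function Hp)) as [b Hb]; exists (add p n b), b.
    split; [apply add_good; auto; apply Hp | split; [apply subset_add | apply rel_add; auto]].
Qed.

Definition atomic_sem (u : V) (R : V -> V -> Prop) : Prop :=
  (exists x y b, tagged2 0 u x y /\ R x b /\ R y b) \/
  (exists x y b c, tagged2 1 u x y /\ R x b /\ R y c /\ b ∈ c) \/
  (exists x b, tagged 2 u x /\ R x b /\ b ∈c A).

Lemma atomic_sem_ext u (R R' : V -> V -> Prop) : (forall x b, R x b <-> R' x b) ->
  (atomic_sem u R <-> atomic_sem u R').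
Proof.
  intros H; unfold atomic_sem.
  split; (intros [[x [y [b K]]] | [[x [y [b [c K]]]] | [x [b K]]]];
    [left; exists x, y, b | right; left; exists x, y, b, c | right; right; exists x, b]);
    rewrite ?H in *; auto; rewrite <- ?H in *; auto.
Qed.

Lemma met_iff u s p : fit u s p -> (met A u s p <-> atomic_sem u (val s p)).
Proof.
  intros [Hp [Hs [Hd _]]]; split.
  - intros [r [[H | [H | H]] B]].
    + destruct H as [x [y [n [T [Hx [Hy _]]]]]]; left; destruct (Hd x n Hx) as [_ [b Hb]].
      exists x, y, b; split; [exact T | split; exists n; auto].
    + destruct H as [x [y [n [m [T [Hx [Hy [Nn [Nm ->]]]]]]]]]; right; left.
      apply (below_ec _ Hp Nn Nm) in B; destruct B as [b [c [Hb [Hc K]]]].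
      exists x, y, b, c; split; [exact T | split; [exists n | split; [exists m|]]]; auto.
    + destruct H as [x [n [T [Hx [Nn ->]]]]]; right; right.
      apply (below_ac _ Hp Nn) in B; destruct B as [b [Hb K]]; exists x, b.
      split; [exact T | split; [exists n|]]; auto.
  - intros [H | [H | H]].
    + destruct H as [x [y [b [T [[n [Hx Hn]] [m [Hy Hm]]]]]]].
      (* Injectivity of [p]: equal values sit at the same number, as the literal for equality
         requires. *)
      assert (n = m) as <- by exact (good_inj Hp Hn Hm).
      exists top; split; [left; exists x, y, n; auto | apply below_top, Hp].
    + destruct H as [x [y [b [c [T [[n [Hx Hn]] [[m [Hy Hm]] K]]]]]]].
      destruct (Hd _ _ Hx) as [Nn _], (Hd _ _ Hy) as [Nm _].
      exists (ec n m); split; [right; left; exists x, y, n, m; auto 6|].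
      apply below_ec; eauto 6.
    + destruct H as [x [b [T [[n [Hx Hn]] K]]]]; destruct (Hd _ _ Hx) as [Nn _].
      exists (ac n); split; [right; right; exists x, n; auto|].
      apply below_ac; eauto.
Qed.

End Valuations.

Local Opaque holds key upd.

(** * Truth *)

Section Truth.
Context {M : structure} {hM : GBC M}.
Notation V := (vset M).
Context (A : vclass M) (Fin Fsub Feq : vclass M).
Context (HF : is_atomic_forcing FA_cond (FA_le A) Fin Fsub Feq).
Notation holds := (holds Feq).
Notation pos u s := (key u s emp).
Notation neg u s := (key u s (sgl emp)).

Lemma holds_dense_iff k f : good f -> (dense f (holds k) <-> holds k f).
Proof.
  intros Hf; split; [apply (holds_dense HF), Hf|]; intros H; apply dense_all.
  intros g Hg L; exact (holds_mono HF Hf Hg L H).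
Qed.

(** Extending [p] does not change the values of the variables, so [met] is constant on the
    extensions of [p] and density becomes plain truth. *)
Lemma holds_atomic_iff u s p : atomic u -> fit u s p ->
  (holds (pos u s) p <-> atomic_sem A u (val s p)) /\
  (holds (neg u s) p <-> ~ atomic_sem A u (val s p)).
Proof.
  intros Ha Hp; assert (Gp := proj1 Hp).
  assert (K : forall q, good q -> subset p q ->
    (met A u s q <-> atomic_sem A u (val s p))).
  { intros q Hq L; rewrite (met_iff A (fit_mono Hp Hq L)); apply atomic_sem_ext.
    intros x b; symmetry; apply (same_mono Hp Hq L). }
  rewrite (holds_atomic HF), (holds_atomic_false HF) by assumption; split; split.
  - intros H; destruct (dense_ex Gp H) as [q [Hq [L Q]]]; apply (K q); auto.
  - intros H; apply dense_all; intros q Hq L; apply K; auto.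
  - intros H Q; apply (H p); auto using subset_refl; apply K; auto using subset_refl.
  - intros H q Hq L Q; apply H, (K q); auto.
Qed.

Lemma holds_neg_pos u v s p : tagged 3 u v -> good p -> (holds (pos u s) p <-> holds (neg v s) p).
Proof.
  intros H Hp; rewrite (holds_true HF) by (auto; exact (not_atomic (le_n 3) H)).
  split; [intros K; apply K|intros K i Hi]; [|apply kid_neg with (v := v) in Hi; auto; subst i];
    rewrite ?flip_emp; auto.
  rewrite (kid_neg _ _ _ H), flip_emp; reflexivity.
Qed.

Lemma holds_neg_neg u v s p : tagged 3 u v -> good p -> (holds (neg u s) p <-> holds (pos v s) p).
Proof.
  intros H Hp; rewrite (holds_false HF) by (auto; exact (not_atomic (le_n 3) H)).
  rewrite <- (holds_dense_iff _ Hp); split; apply dense_imp; intros g _ _.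
  - intros [i [Hi K]]; rewrite (kid_neg _ _ _ H), flip_sgl in Hi; subst; exact K.
  - intros K; exists (pos v s); rewrite (kid_neg _ _ _ H), flip_sgl; auto.
Qed.

Lemma holds_conj_pos u Phi s p : tagged 4 u Phi -> good p ->
  (holds (pos u s) p <-> forall v, v ∈ Phi -> holds (pos v s) p).
Proof.
  intros H Hp; rewrite (holds_true HF) by (auto; apply (not_atomic (k := 4) (x := Phi)); auto with arith).
  split.
  - intros K v Hv; apply K; rewrite (kid_conj _ _ _ H); eauto.
  - intros K i Hi; rewrite (kid_conj _ _ _ H) in Hi; destruct Hi as [v [Hv ->]]; auto.
Qed.

Lemma holds_conj_neg u Phi s p : tagged 4 u Phi -> good p ->
  (holds (neg u s) p <-> dense p (fun q => exists v, v ∈ Phi /\ holds (neg v s) q)).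
Proof.
  intros H Hp; rewrite (holds_false HF) by (auto; apply (not_atomic (k := 4) (x := Phi)); auto with arith).
  split; apply dense_imp; intros q _ _.
  - intros [i [Hi K]]; rewrite (kid_conj _ _ _ H) in Hi; destruct Hi as [v [Hv ->]]; eauto.
  - intros [v [Hv K]]; exists (neg v s); rewrite (kid_conj _ _ _ H); eauto.
Qed.

Lemma holds_all_pos u x v s p : tagged2 5 u x v -> good p ->
  (holds (pos u s) p <-> forall n, is_nat n -> holds (pos v (upd s x n)) p).
Proof.
  intros H Hp; assert (H' := H); apply tagged2_tagged in H'.
  rewrite (holds_true HF) by (auto; apply (not_atomic (k := 5) (x := pr x v)); auto with arith).
  split.
  - intros K n Hn; apply K; rewrite (kid_all _ _ _ H); eauto.
  - intros K i Hi; rewrite (kid_all _ _ _ H) in Hi; destruct Hi as [n [Hn ->]]; auto.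
Qed.

Lemma holds_all_neg u x v s p : tagged2 5 u x v -> good p ->
  (holds (neg u s) p <-> dense p (fun q => exists n, is_nat n /\ holds (neg v (upd s x n)) q)).
Proof.
  intros H Hp; assert (H' := H); apply tagged2_tagged in H'.
  rewrite (holds_false HF) by (auto; apply (not_atomic (k := 5) (x := pr x v)); auto with arith).
  split; apply dense_imp; intros q _ _.
  - intros [i [Hi K]]; rewrite (kid_all _ _ _ H) in Hi; destruct Hi as [n [Hn ->]]; eauto.
  - intros [n [Hn K]]; exists (neg v (upd s x n)); rewrite (kid_all _ _ _ H); eauto.
Qed.

Ltac dp_local ::= first [simple apply DP_holds | simple apply DP_free_vars].

(** Once [p] determines the values of the variables, it decides every formula,
    and the decision depends on these values only: two conditions giving the
    same values have extensions that give any further value [b], at possibly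
    different numbers. *)
Theorem decision u : forall s p s' p', fit u s p -> fit u s' p' -> same s p s' p' ->
  (holds (pos u s) p <-> holds (pos u s') p') /\ (holds (neg u s) p <-> ~ holds (pos u s) p).
Proof.
  revert u; match goal with |- forall k, @?Q k => refine (@formula_induction M hM Q _ _) end.
  { unfold fit, same, val; d1. }
  intros u IH3 IH4 IH5 s p s' p' Hp Hp' Hs.
  assert (Gp := proj1 Hp); assert (Gp' := proj1 Hp').
  assert (D : exists t, free_vars u t) by (destruct Hp as [_ [_ [_ [t [Ht _]]]]]; eauto).
  destruct D as [t Ht]; destruct (formula_cases Ht) as [Ha | [[v H] | [[Phi H] | [x [v H]]]]].
  - destruct (holds_atomic_iff Ha Hp) as [-> ->], (holds_atomic_iff Ha Hp') as [-> _].
    rewrite (atomic_sem_ext A u _ _ Hs); tauto.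
  - rewrite !(holds_neg_pos s H), !(holds_neg_neg _ H), (holds_neg_pos s' H) by assumption.
    assert (F := fit_neg H Hp); assert (F' := fit_neg H Hp').
    destruct (IH3 v H s p s' p' F F' Hs) as [E N].
    destruct (IH3 v H s' p' s p F' F) as [_ N']; [intros y c; symmetry; apply Hs|].
    rewrite N, N', E; split; [reflexivity|]; split; [intros K1 K2; exact (K2 K1) | apply NNPP].
  - rewrite !(holds_conj_pos _ H), (holds_conj_neg _ H) by assumption; split.
    + assert (E : forall v, v ∈ Phi -> (holds (pos v s) p <-> holds (pos v s') p')).
      { intros v Hv; apply (IH4 Phi v H Hv s p s' p'); [| |exact Hs].
        - exact (fit_conj v H Hv Hp).
        - exact (fit_conj v H Hv Hp'). }
      split; intros K v Hv; apply (E v Hv), K, Hv.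
    (* The hypothesis is needed at extensions of [p], since a false conjunct is found only densely
       below [p]. *)
    + assert (N : forall v q, v ∈ Phi -> good q -> subset p q ->
        (holds (neg v s) q <-> ~ holds (pos v s) q)).
      { intros v q Hv Hq L; assert (F := fit_conj v H Hv (fit_mono Hp Hq L)).
        apply (IH4 Phi v H Hv s q s q F F); intros y c; reflexivity. }
      split.
      * intros K Q; destruct (dense_ex Gp K) as [q [Hq [L [v [Hv Kv]]]]].
        apply N in Kv; auto; apply Kv; exact (holds_mono HF Gp Hq L (Q v Hv)).
      * intros K; apply not_all_ex_not in K; destruct K as [v K]; apply imply_to_and in K.
        destruct K as [Hv K]; apply N in K; auto using subset_refl.
        apply dense_all; intros q Hq L; exists v; split; [exact Hv|].
        exact (holds_mono HF Gp Hq L K).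
  (* Homogeneity in the form used here: numbers [n1] and [n2] that carry the same value [b] are
     interchangeable. *)
  - assert (E : forall s1 p1 s2 p2 q1 q2 n1 n2 b, fit u s1 p1 -> fit u s2 p2 -> same s1 p1 s2 p2 ->
      good q1 -> good q2 -> subset p1 q1 -> subset p2 q2 -> is_nat n1 -> is_nat n2 ->
      rel q1 n1 b -> rel q2 n2 b ->
      (holds (pos v (upd s1 x n1)) q1 <-> holds (pos v (upd s2 x n2)) q2) /\
      (holds (neg v (upd s1 x n1)) q1 <-> ~ holds (pos v (upd s1 x n1)) q1)).
    { intros s1 p1 s2 p2 q1 q2 n1 n2 b F1 F2 S G1 G2 L1 L2 N1 N2 B1 B2.
      apply (IH5 x v H (upd s1 x n1) q1 (upd s2 x n2) q2).
      - apply (fit_all H); [exact N1 | exists b; exact B1 | exact (fit_mono F1 G1 L1)].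
      - apply (fit_all H); [exact N2 | exists b; exact B2 | exact (fit_mono F2 G2 L2)].
      - apply same_upd with b; auto; intros y c.
        rewrite <- (same_mono F1 G1 L1 y c), <- (same_mono F2 G2 L2 y c); apply S. }
    (* An extension gives [n] a value [b]; on the other side some number [n1] is made to carry [b],
       and the instance at [n1] is transferred. *)
    assert (P : forall s1 p1 s2 p2, fit u s1 p1 -> fit u s2 p2 -> same s1 p1 s2 p2 ->
      (forall n, is_nat n -> holds (pos v (upd s1 x n)) p1) ->
      forall n, is_nat n -> holds (pos v (upd s2 x n)) p2).
    { intros s1 p1 s2 p2 F1 F2 S K n Hn; assert (G1 := proj1 F1); assert (G2 := proj1 F2).
      apply (holds_dense HF); [exact G2|]; intros g Hg L.
      destruct (good_extend_dom Hg Hn) as [q2 [b [Hq2 [L2 B2]]]].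
      destruct (good_extend_ran b G1) as [q1 [n1 [Hq1 [L1 [N1 B1]]]]].
      exists q2; split; [exact Hq2 | split; [exact L2|]].
      apply (E s1 p1 s2 p2 q1 q2 n1 n b); auto.
      - exact (subset_trans L L2).
      - exact (holds_mono HF G1 Hq1 L1 (K n1 N1)). }
    rewrite !(holds_all_pos _ H), (holds_all_neg _ H) by assumption; split.
    + split; [apply P; auto | apply P; auto; intros y c; symmetry; apply Hs].
    + split.
      * intros K Q; destruct (dense_ex Gp K) as [q [Hq [L [n [Hn Kn]]]]].
        destruct (good_extend_dom Hq Hn) as [q' [b [Hq' [L' B]]]].
        assert (Kn' := holds_mono HF Hq Hq' L' Kn).
        assert (Lq := subset_trans L L').
        apply (E s p s p q' q' n n b) in Kn'; auto; [|intros y c; reflexivity].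
        apply Kn'; exact (holds_mono HF Gp Hq' Lq (Q n Hn)).
      * intros K; apply not_all_ex_not in K; destruct K as [n K]; apply imply_to_and in K.
        destruct K as [Hn K].
        (* The instance at [n] also fails at some extension deciding the value at [n]; otherwise it
           would hold densely, hence at [p]. *)
        assert (R : exists q b, good q /\ subset p q /\ rel q n b /\
          ~ holds (pos v (upd s x n)) q).
        { apply NNPP; intros R; apply K, (holds_dense HF); [exact Gp|]; intros g Hg L.
          destruct (good_extend_dom Hg Hn) as [q [b [Hq [Lq B]]]].
          exists q; split; [exact Hq | split; [exact Lq|]]; apply NNPP; intros N.
          apply R; exists q, b; split; [exact Hq | split; [exact (subset_trans L Lq)|]]; auto. }
        destruct R as [q0 [b [Hq0 [L0 [B0 N0]]]]]; intros g Hg L.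
        (* Below [g] the number [n] may take a value other than [b]. Another number [m] can carry
           [b], and by [E] the instance at [m] is false. *)
        destruct (good_extend_ran b Hg) as [q [m [Hq [Lq [Hm Bm]]]]].
        exists q; split; [exact Hq | split; [exact Lq|]]; exists m; split; [exact Hm|].
        assert (Lp := subset_trans L Lq).
        destruct (E s p s p q q0 m n b) as [E1 E2]; auto; [intros y c; reflexivity|].
        apply E2; rewrite E1; exact N0.
Qed.

Definition matches (a s p : V) : Prop := forall x b, rel a x b <-> val s p x b.

Lemma matches_exist (u a : V) : is_valuation u a -> exists s p, fit u s p /\ matches a s p.
Proof.
  intros [Ha [Fa [_ [t [Ht Hv]]]]].
  (* A finite injection whose range contains all values of [a], by induction on the finite set [a];
     repeated values are entered once. *)
  assert (P : exists p, is_coll p /\ forall x b, rel a x b -> in_ran p b).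
  { clear Ha Hv; revert a Fa; by_ind2 (@finite_induction M hM).
    - exists emp; split; [apply coll_emp|]; intros x b H; destruct (rel_emp H).
    - intros f w [p [Hp K]].
      destruct (classic (exists x b, w = pr x b)) as [[x [b ->]] | N].
      + destruct (extend_ran b Hp) as [q [n [Hq [L [_ B]]]]]; exists q; split; [exact Hq|].
        intros y c H; apply rel_add in H; destruct H as [H | [_ ->]]; [|exists n; exact B].
        destruct (K y c H) as [m Hm]; exists m; exact (rel_subset L Hm).
      + exists p; split; [exact Hp|]; intros x b H; rewrite rel_iff, in_cup, in_up in H.
        destruct H as [H | H]; [apply (K x), rel_iff, H|].
        destruct N; exists x, b; intuition. }
  destruct P as [p0 [Hp0 K0]].
  (* One more pair makes the condition nonempty even if [a] is empty. *)
  destruct (@fresh_nat M hM p0) as [n0 [Hn0 D0]]; [apply Hp0|].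
  destruct (@fresh_set M hM p0) as [b0 R0]; [apply Hp0|].
  set (p := add p0 n0 b0).
  assert (Hp : good p) by (apply add_good; auto).
  assert (K : forall x b, rel a x b -> in_ran p b).
  { intros x b H; destruct (K0 x b H) as [n Hn]; exists n; apply rel_add; auto. }
  (* The assignment sends [x] to the number at which [p] takes the value of [x], unique by
     injectivity. *)
  destruct (@small_img M hM (fun w w' => exists x b n, w = pr x b /\ rel p n b /\ w' = pr x n) a)
    as [s Hs]; [d2| |].
  { intros w y z [x [b [n [-> [Hn ->]]]]] [x' [b' [n' [E [Hn' ->]]]]].
    apply pr_inj in E; destruct E; subst; f_equal; exact (good_inj Hp Hn Hn'). }
  assert (Rs : forall x n, rel s x n <-> exists b, rel a x b /\ rel p n b).
  { intros x n; rewrite rel_iff, (Hs (pr x n)); split.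
    - intros [w [Hw [x' [b [n' [-> [Hn E]]]]]]]; apply pr_inj in E; destruct E; subst.
      exists b; rewrite rel_iff; auto.
    - intros [b [H Hn]]; apply rel_iff in H; exists (pr x b); split; [exact H|].
      exists x, b, n; auto. }
  assert (Fs : is_function s).
  { split.
    - intros w Hw; apply Hs in Hw; destruct Hw as [_ [_ [x [_ [n [_ [_ ->]]]]]]].
      exists x, n; apply opair_iff; reflexivity.
    - intros x n n'; rewrite !Rs; intros [b [H L]] [b' [H' L']].
      assert (b = b') as <- by exact (proj2 Ha x b b' H H'); exact (good_inj Hp L L'). }
  exists s, p; split.
  - split; [exact Hp | split; [exact Fs | split]].
    + intros x n H; apply Rs in H; destruct H as [b [_ L]].
      assert (D : in_dom p n) by (exists b; exact L); split; [apply Hp, D | exact D].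
    + exists t; split; [exact Ht|]; intros x Hx; destruct (Hv x Hx) as [b Hb].
      destruct (K x b Hb) as [n Hn]; exists n; apply Rs; eauto.
  - intros x b; split.
    + intros H; destruct (K x b H) as [n Hn]; exists n; split; [apply Rs; eauto | exact Hn].
    + intros [n [H Hn]]; apply Rs in H; destruct H as [c [H Hc]].
      rewrite (proj2 (good_function Hp) n b c Hn Hc); exact H.
Qed.

(** A valuation has many representations by [s] and [p]. The class asks for one that satisfies the
    key, and [decision] makes the choice irrelevant. *)
Lemma truth_class : exists T : vclass M, (forall w, w ∈c T ->
    exists u a, is_opair w u a /\ is_valuation u a) /\
  forall u a s p, is_valuation u a -> fit u s p -> matches a s p ->
    (crel T u a <-> holds (pos u s) p).
Proof.
  assert (D : D1 (fun w => exists u a, w = pr u a /\ is_valuation u a /\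
    exists s p, fit u s p /\ matches a s p /\ holds (pos u s) p)).
  { unfold is_valuation, fit, matches, val, is_ordinal, transitive_set; d1. }
  destruct D as [T HT]; exists T; split.
  - intros w Hw; apply HT in Hw; destruct Hw as [u [a [-> [Hv _]]]]; exists u, a.
    split; [apply opair_iff; reflexivity | exact Hv].
  - intros u a s p Hv Hp Ha; rewrite crel_iff, <- HT; split.
    + intros [u' [a' [E [_ [s' [p' [Hp' [Ha' H]]]]]]]]; apply pr_inj in E; destruct E; subst u' a'.
      apply (@decision u s' p' s p); auto; intros x b; rewrite <- (Ha x b), <- (Ha' x b).
      reflexivity.
    + intros H; exists u, a; split; [reflexivity | split; [exact Hv|]]; exists s, p; auto.
Qed.

Lemma atomic_truth T u a : (forall u a s p, is_valuation u a -> fit u s p -> matches a s p ->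
    (crel T u a <-> holds (pos u s) p)) ->
  is_valuation u a -> atomic u -> (crel T u a <-> atomic_sem A u (rel a)).
Proof.
  intros HT Hv Ha; destruct (matches_exist Hv) as [s [p [Hp Hm]]].
  rewrite (HT u a s p Hv Hp Hm), (proj1 (holds_atomic_iff Ha Hp)); apply atomic_sem_ext.
  intros x b; symmetry; apply Hm.
Qed.

Lemma update_valuation (u a x v b a' : V) : is_valuation u a -> tagged2 5 u x v ->
  is_update a' a x b -> is_valuation v a'.
Proof.
  intros [Ha [Fa [Oa [t [Ht Hv]]]]] H [Hr Hu].
  destruct (free_vars_all H Ht) as [Ox [t' [Ht' L]]].
  split; [|split; [|split]].
  - split; [exact Hr|]; intros y c d; rewrite !Hu; intros [[-> ->] | [N K]] [[E ->] | [N' K']];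
      try tauto; exact (proj2 Ha y c d K K').
  - apply (subset_finite (x := cup a (up (pr x b) (pr x b)))); [apply cup_finite, Fa|].
    intros w Hw; destruct (Hr w Hw) as [y [c E]]; apply opair_iff in E; subst w.
    apply rel_iff, Hu in Hw; rewrite in_cup, in_up; destruct Hw as [[-> ->] | [_ Hw]]; auto.
    left; apply rel_iff, Hw.
  - intros y [c Hc]; apply Hu in Hc; destruct Hc as [[-> _] | [_ Hc]]; [exact Ox|].
    apply Oa; exists c; exact Hc.
  - exists t'; split; [exact Ht'|]; intros y Hy; destruct (classic (y = x)) as [-> | N].
    + exists b; apply Hu; auto.
    + destruct (Hv y (L y Hy N)) as [c Hc]; exists c; apply Hu; auto.
Qed.

Lemma upd_update (a x b : V) : is_function a -> is_update (upd a x b) a x b.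
Proof. intros Ha; split; [apply upd_function, Ha | intros; apply rel_upd]. Qed.

Lemma matches_mono (u a s p q : V) : fit u s p -> good q -> subset p q -> matches a s p -> matches a s q.
Proof.
  intros Hp Hq L Hm x b; rewrite (Hm x b); apply (same_mono Hp Hq L).
Qed.

Lemma matches_update (a s p a' x n b : V) : good p -> matches a s p -> rel p n b ->
  is_update a' a x b -> matches a' (upd s x n) p.
Proof.
  intros Hp Hm Hb [_ Hu] y c; rewrite (Hu y c), (val_upd _ _ _ _ Hp Hb), (Hm y c); reflexivity.
Qed.

Theorem truth_predicate_exists : exists T : vclass M, is_truth_predicate A T.
Proof.
  destruct truth_class as [T [HT HT']]; exists T; split.
  - exact HT.
  - intros u a x y Hv H; rewrite (atomic_truth HT' Hv) by (exists x, y; auto).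
    split.
    + intros [[x' [y' [b [K [L N]]]]] | [[x' [y' [b [c [K _]]]]] | [x' [b [K _]]]]];
        unfold code_eq in H; rewrite !tagged2_tagged in *; destruct (tagged_unique H K) as [E E'];
        try discriminate; apply pr_inj in E'; destruct E'; subst; exists b, b; auto.
    + intros [b [c [K [L <-]]]]; left; exists x, y, b; auto.
  - intros u a x y Hv H; rewrite (atomic_truth HT' Hv) by (exists x, y; auto).
    split.
    + intros [[x' [y' [b [K [L N]]]]] | [[x' [y' [b [c [K [L [N Q]]]]]]] | [x' [b [K _]]]]];
        unfold code_mem in H; rewrite !tagged2_tagged in *; destruct (tagged_unique H K) as [E E'];
        try discriminate; apply pr_inj in E'; destruct E'; subst; exists b, c; auto.
    + intros [b [c [K [L N]]]]; right; left; exists x, y, b, c; auto.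
  - intros u a x Hv H; rewrite (atomic_truth HT' Hv) by (exists x, x; auto).
    split.
    + intros [[x' [y' [b [K [L N]]]]] | [[x' [y' [b [c [K _]]]]] | [x' [b [K [L N]]]]]];
        unfold code_inA in H; rewrite ?tagged2_tagged in *; destruct (tagged_unique H K) as [E E'];
        try discriminate; subst; exists b; auto.
    + intros [b [K L]]; right; right; exists x, b; auto.
  - intros u a Phi Hv H; destruct (matches_exist Hv) as [s [p [Hp Hm]]].
    rewrite (HT' u a s p Hv Hp Hm), (holds_conj_pos _ H) by apply Hp.
    assert (K : forall v, v ∈ Phi -> (crel T v a <-> holds (pos v s) p)).
    { intros v Hi; apply HT'; [|exact (fit_conj v H Hi Hp)|exact Hm].
      destruct Hv as [Ha [Fa [Oa [t [Ht L]]]]]; split; [|split; [|split]]; auto.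
      destruct (free_vars_conj v H Hi Ht) as [t' [Ht' L']]; exists t'; auto. }
    split; intros L v Hi; apply K; auto.
  - intros u a v Hv H; destruct (matches_exist Hv) as [s [p [Hp Hm]]].
    rewrite (HT' u a s p Hv Hp Hm), (holds_neg_pos _ H) by apply Hp.
    assert (Hp' := fit_neg H Hp).
    rewrite (HT' v a s p); auto.
    + apply (@decision v s p s p); auto; intros x b; reflexivity.
    + destruct Hv as [Ha [Fa [Oa [t [Ht L]]]]]; split; [|split; [|split]]; auto.
      exists t; split; [exact (free_vars_neg H Ht) | exact L].
  - intros u a x v Hv H; destruct (matches_exist Hv) as [s [p [Hp Hm]]].
    assert (Gp := proj1 Hp).
    rewrite (HT' u a s p Hv Hp Hm), (holds_all_pos _ H) by exact Gp; split.
    (* Each set [b] is the value at some number in an extension, so the conjunction over numbers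
       covers all sets. *)
    + intros K b a' Ha'; destruct (good_extend_ran b Gp) as [q [n [Hq [L [Hn B]]]]].
      apply (HT' v a' (upd s x n) q).
      * exact (update_valuation Hv H Ha').
      * apply (fit_all H Hn); [exists b; exact B | exact (fit_mono Hp Hq L)].
      * exact (matches_update Hq (matches_mono Hp Hq L Hm) B Ha').
      * exact (holds_mono HF Gp Hq L (K n Hn)).
    (* Conversely, densely many conditions give [n] a value [b], and truth at [b] yields the
       instance at [n]. *)
    + intros K n Hn; apply (holds_dense HF); [exact Gp|]; intros g Hg L.
      destruct (good_extend_dom Hg Hn) as [q [b [Hq [Lq B]]]].
      exists q; split; [exact Hq | split; [exact Lq|]].
      assert (Lp := subset_trans L Lq).
      assert (Ha' : is_update (upd a x b) a x b) by apply upd_update, Hv.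
      apply (HT' v (upd a x b) (upd s x n) q); eauto.
      * exact (update_valuation Hv H Ha').
      * apply (fit_all H Hn); [exists b; exact B | exact (fit_mono Hp Hq Lp)].
      * exact (matches_update Hq (matches_mono Hp Hq Lp Hm) B Ha').
Qed.

End Truth.

Unset Implicit Arguments.

Theorem theorem17 (M : structure) (hM : GBC M) (A : vclass M)
  (hF : admits_atomic_forcing FA_cond (FA_le A)) :
  exists T : vclass M, is_truth_predicate A T.
Proof.
  destruct hF as [Fin [Fsub [Feq HF]]]; exact (truth_predicate_exists HF).
Qed.
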